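(* Let $(W,S)$ be a Coxeter system with $S=\{s_i\}_{i\in I}$ (not necessarily finite) and Coxeter matrix $(m_{ij})_{i,j\in I}$. Let $i,j,k\in I$, and let $x_1\in [s_i]R_{W,S}[s_j]$ and $x_2\in [s_j]R_{W,S}[s_k]$ be elements of $R_{W,S}$ such that $x_1x_2=0$. Then either $x_1=0$ or $x_2=0$.
   Context: A Coxeter matrix is $(m_{ij})_{i,j\in I}$ with $m_{ii}=1$ and $m_{ij}=m_{ji}\in\{2,3,\dots\}\cup\{\infty\}$ for $i\neq j$; the Coxeter system $(W,S)$ has $W=\langle s_i\ (i\in I)\mid (s_ks_l)^{m_{kl}}=1 \text{ whenever } m_{kl}\neq\infty\rangle$. The graph $\Gamma_{W,S}$ has vertex set $S$ and one directed edge $y_{ij}=[s_is_j]$ (origin $s_i$, terminus $s_j$) for each ordered pair $i\ne j$ with $m_{ij}\geq 3$ (including $m_{ij}=\infty$); write $\bar y_{ij}=y_{ji}$. Paths of length $n\ge1$ are sequences of edges $y_1\cdots y_n$ with the terminus of each edge equal to the origin of the next; a path is also written by its successive vertices as $[s_{i_0}s_{i_1}\cdots s_{i_n}]$. Paths of length $0$ are the vertices $[s]$, $s\in S$. The path algebra $P_{W,S}=\mathbb{Z}\Gamma_{W,S}$ is the free $\mathbb{Z}$-module on all paths, with multiplication given by concatenation when the terminus of the first path equals the origin of the second, and $0$ otherwise; the $[s]$ are orthogonal idempotents. For an integer $m\geq 3$ let $C_m(t)\in\mathbb{Z}[t]$ be the (monic) minimal polynomial of $4\cos^2(\pi/m)$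 over $\mathbb{Q}$. For each edge $y_{ij}$ with $3\le m_{ij}<\infty$ put $C_{y_{ij}}=C_{m_{ij}}(y_{ij}\bar y_{ij})=C_{m_{ij}}([s_is_js_i])$, evaluated in the ring $[s_i]P_{W,S}[s_i]$ with identity $[s_i]$ (so the constant term is multiplied by $[s_i]$). Let $I_{W,S}$ be the two-sided ideal of $P_{W,S}$ generated by all $C_{y_{ij}}$ with $3\le m_{ij}<\infty$, and $R_{W,S}=P_{W,S}/I_{W,S}$ (unital iff $S$ is finite). The image of $[s]$ in $R_{W,S}$ is still denoted $[s]$. *)

(* Defs.v *)
From HB Require Import structures.
From mathcomp Require Import all_boot all_order all_algebra finmap ring.
From mathcomp Require Import boolp classical_sets reals Rstruct trigo.
From mathcomp.multinomials Require Import monalg.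

Set Implicit Arguments.
Unset Strict Implicit.
Unset Printing Implicit Defensive.

Import GRing.Theory Num.Theory.

Local Open Scope ring_scope.
Local Open Scope quotient_scope.

(** [None] stands for the value [oo]. *)
Record coxeterMatrix (I : choiceType) := CoxeterMatrix {
  cox_ord :> I -> I -> option nat;
  cox_ord_diag : forall i, cox_ord i i = Some 1%N;
  cox_ord_sym : forall i j, cox_ord i j = cox_ord j i;
  cox_ord_ge2 : forall i j n, i != j -> cox_ord i j = Some n -> (2 <= n)%N
}.

Definition coxeter_relations (I : choiceType) (m : coxeterMatrix I)
    (G : groupType) (s : I -> G) : Prop :=
  forall k l n, m k l = Some n -> ((s k * s l) ^+ n = 1)%g.

(** The presentation of [W] is expressed by its universal property. *)
Record coxeterSystem (I : choiceType) := CoxeterSystem {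
  cox_mx :> coxeterMatrix I;
  cox_group : groupType;
  cox_gen : I -> cox_group;
  cox_gen_rel : coxeter_relations cox_mx cox_gen;
  cox_gen_univ : forall (G : groupType) (f : I -> G),
    coxeter_relations cox_mx f ->
    exists phi : {multiplicative cox_group -> G},
      (forall i, phi (cox_gen i) = f i) /\
      (forall psi : {multiplicative cox_group -> G},
         (forall i, psi (cox_gen i) = f i) -> psi =1 phi)
}.

Section PathAlgebra.
Variables (I : choiceType) (m : coxeterMatrix I).

Definition edge : rel I := fun i j =>
  (i != j) && (if m i j is Some n then (3 <= n)%N else true).

Lemma edge_sym i j : edge i j = edge j i.
Proof. by rewrite /edge eq_sym cox_ord_sym. Qed.

(** As [edge] is a relation, a path is determined by its successive vertices;
    [(i, s)] encodes the path that starts at [i] and then visits the vertices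
    listed in [s], so that its length is [size s]. *)
Record gpath := GPath {
  gpath_val : I * seq I;
  gpath_valP : path edge gpath_val.1 gpath_val.2
}.

HB.instance Definition _ := [isSub for gpath_val].
HB.instance Definition _ := [Choice of gpath by <:].

Definition origin (p : gpath) : I := (val p).1.
Definition terminus (p : gpath) : I := last (val p).1 (val p).2.

(** Only meaningful when [terminus p = origin q], see [gpath_cat_val]. *)
Definition gpath_cat (p q : gpath) : gpath :=
  insubd p ((val p).1, (val p).2 ++ (val q).2).

Lemma gpath_cat_val p q : terminus p = origin q ->
  val (gpath_cat p q) = ((val p).1, (val p).2 ++ (val q).2).
Proof.
move=> pq; rewrite /gpath_cat val_insubd cat_path (valP p) /=.
by move: pq; rewrite /terminus /origin => ->; rewrite (valP q).
Qed.

Definition vertex_path (i : I) : gpath := @GPath (i, [::]) isT.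

Lemma edge_pathP i j : edge i j -> path edge i [:: j].
Proof. by rewrite /= andbT. Qed.

Definition edge_path i j (e : edge i j) : gpath :=
  @GPath (i, [:: j]) (edge_pathP e).

Definition pathAlg := {malg int[gpath]}.
HB.instance Definition _ := GRing.Lmodule.on pathAlg.

Definition gpath_mul (p q : gpath) : pathAlg :=
  if terminus p == origin q then << gpath_cat p q >> else 0.

Definition pmul (x y : pathAlg) : pathAlg :=
  \sum_(p <- msupp x) \sum_(q <- msupp y) (x@_p * y@_q) *: gpath_mul p q.

Definition idem (i : I) : pathAlg := << vertex_path i >>.
Definition edge_elt i j (e : edge i j) : pathAlg := << edge_path e >>.

Lemma pmulwE (d1 d2 : {fset gpath}) (x y : pathAlg) :
  (msupp x `<=` d1)%fset -> (msupp y `<=` d2)%fset ->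
  pmul x y = \sum_(p <- d1) \sum_(q <- d2) (x@_p * y@_q) *: gpath_mul p q.
Proof.
move=> le1 le2; rewrite /pmul (big_fset_incl _ le1) /=; last first.
  move=> p _ /mcoeff_outdom ->; rewrite big1 // => q _.
  by rewrite mul0r scale0r.
apply: eq_bigr => p _; rewrite (big_fset_incl _ le2) //.
by move=> q _ /mcoeff_outdom ->; rewrite mulr0 scale0r.
Qed.

Lemma pmulDl x y z : pmul (x + y) z = pmul x z + pmul y z.
Proof.
pose d := (msupp x `|` msupp y)%fset.
rewrite (@pmulwE d (msupp z)) ?msuppD_le ?fsubset_refl //.
rewrite (@pmulwE d (msupp z) x) ?fsubsetUl ?fsubset_refl //.
rewrite (@pmulwE d (msupp z) y) ?fsubsetUr ?fsubset_refl //.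
rewrite -big_split; apply: eq_bigr => p _ /=; rewrite -big_split.
by apply: eq_bigr => q _ /=; rewrite mcoeffD mulrDl scalerDl.
Qed.

Lemma pmulDr x y z : pmul x (y + z) = pmul x y + pmul x z.
Proof.
pose d := (msupp y `|` msupp z)%fset.
rewrite (@pmulwE (msupp x) d) ?msuppD_le ?fsubset_refl //.
rewrite (@pmulwE (msupp x) d x y) ?fsubsetUl ?fsubset_refl //.
rewrite (@pmulwE (msupp x) d x z) ?fsubsetUr ?fsubset_refl //.
rewrite -big_split; apply: eq_bigr => p _ /=; rewrite -big_split.
by apply: eq_bigr => q _ /=; rewrite mcoeffD mulrDr scalerDl.
Qed.

Lemma pmulBl x y z : pmul (x - y) z = pmul x z - pmul y z.
Proof. by apply: (addIr (pmul y z)); rewrite -pmulDl !subrK. Qed.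

Lemma pmulBr x y z : pmul x (y - z) = pmul x y - pmul x z.
Proof. by apply: (addIr (pmul x z)); rewrite -pmulDr !subrK. Qed.

End PathAlgebra.

Arguments idem {I} m i.

(** [p] is the minimal polynomial of [x] over the rationals. *)
Definition is_minpoly (x : Rdefinitions.R) (p : {poly rat}) : Prop :=
  [/\ p \is monic, root (map_poly ratr p) x &
      forall q : {poly rat}, q != 0 -> root (map_poly ratr q) x ->
        (size p <= size q)%N].

Definition cos_sqr4 (n : nat) : Rdefinitions.R := 4 * trigo.cos (trigo.pi / n%:R) ^+ 2.

(** The default value [0] of [xget] is not used, see [cox_polyP]. *)
Definition cox_poly (n : nat) : {poly int} :=
  xget 0 [set p : {poly int} | is_minpoly (cos_sqr4 n) (map_poly intr p)]%classic.

Lemma minpoly_int_ex (x : Rdefinitions.R) (f : {poly int}) :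
  f \is monic -> root (map_poly intr f) x ->
  exists p : {poly int}, is_minpoly x (map_poly intr p).
Proof.
move=> fmon fx.
have intrR (q : {poly int}) :
    map_poly (ratr : rat -> Rdefinitions.R) (map_poly intr q) = map_poly intr q.
  by rewrite -map_poly_comp; apply: eq_map_poly => a /=; rewrite ratr_int.
pose P n := `[< exists q : {poly rat},
  [/\ q \is monic, root (map_poly ratr q) x & size q = n] >].
have exP : exists n, P n.
  exists (size f); apply/asboolP; exists (map_poly intr f); split.
  - rewrite monicE lead_coef_map_inj ?(monicP fmon) ?rmorph1 //.
    exact: intr_inj.
  - by rewrite intrR.
  - by rewrite size_rat_int_poly.
case: (ex_minnP exP) => _ /asboolP[q [qmon qx <-]] qmin.
have {}qmin (r : {poly rat}) :
    r != 0 -> root (map_poly ratr r) x -> (size q <= size r)%N.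
  move=> r0 rx; have lr0 : (lead_coef r)^-1 != 0 by rewrite invr_eq0 lead_coef_eq0.
  rewrite -(size_scale r lr0).
  apply: qmin; apply/asboolP.
  exists ((lead_coef r)^-1 *: r); split => //.
  - by rewrite monicE lead_coefZ mulVf // lead_coef_eq0.
  - by rewrite map_polyZ /= rootZ // fmorph_eq0.
have qf : q %| map_poly intr f.
  have [//|rN0] := eqVneq (map_poly intr f %% q) 0; first by move/eqP.
  have q0 := monic_neq0 qmon.
  suff /(qmin _ rN0) : root (map_poly ratr (map_poly intr f %% q)) x.
    by rewrite leqNgt ltn_modp q0.
  have := fx; rewrite -intrR {1}(divp_eq (map_poly intr f) q).
  by rewrite rmorphD rmorphM /root hornerD hornerM (eqP qx) mulr0 add0r.
have [p [a a0 qE] [r fE]] := dvdpP_rat_int qf.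
have lpr : lead_coef p * lead_coef r = 1.
  by rewrite -lead_coefM -fE; exact/monicP.
have lp2 : lead_coef p * lead_coef p = 1.
  have : lead_coef p \is a GRing.unit by apply/unitrPr; exists (lead_coef r).
  by rewrite unitrE => /eqP; rewrite -[(_ ^-1)]/(lead_coef p).
exists (lead_coef p *: p).
suff -> : map_poly intr (lead_coef p *: p) = q by split.
have := monicP qmon; rewrite qE lead_coefZ lead_coef_map_inj //; last exact: intr_inj.
move=> alp; rewrite map_polyZ /=; congr (_ *: _).
apply: (mulIf (_ : ((lead_coef p)%:~R : rat) != 0)).
  by rewrite intr_eq0; apply: contra_eq_neq lp2 => ->; rewrite mul0r.
by rewrite alp -rmorphM /= lp2.
Qed.

(** The rescaled Chebyshev polynomials [T_k] and [T_(k+1)], where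
    [T_k (2 cos t) = 2 cos (k t)]. *)
Fixpoint chebyshev_pair (k : nat) : {poly int} * {poly int} :=
  if k is k'.+1 then
    let fg := chebyshev_pair k' in (fg.2, 'X * fg.2 - fg.1)
  else (2%:P, 'X).

Lemma chebyshev_pairP k (fg := chebyshev_pair k) :
  [/\ (size fg.1 <= k.+1)%N, fg.2 \is monic, size fg.2 = k.+2 &
      forall t : Rdefinitions.R,
        (map_poly intr fg.1).[2 * cos t] = 2 * cos (t *+ k) /\
        (map_poly intr fg.2).[2 * cos t] = 2 * cos (t *+ k.+1)].
Proof.
rewrite {}/fg; elim: k => [|k] /=.
  split; rewrite ?monicX ?size_polyX ?size_polyC // => t.
  by rewrite map_polyC map_polyX hornerC hornerX mulr0n mulr1n cos0 mulr1.
case: chebyshev_pair => f g /= [fs gm gs ev].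
have sX : size ('X * g : {poly int}) = k.+3.
  by rewrite mulrC size_mulX ?gs ?monic_neq0.
have sf : (size (- f) < size ('X * g : {poly int})%R)%N.
  by rewrite sX size_polyN ltnS (leq_trans fs).
split; first by rewrite gs.
- by rewrite monicE lead_coefDl // lead_coefM lead_coefX mul1r (monicP gm).
- by rewrite size_polyDl.
move=> t; have [ef eg] := ev t; split=> //.
rewrite rmorphB rmorphM /= map_polyX hornerD hornerN hornerM hornerX ef eg.
have -> : t *+ k = t *+ k.+1 - t by rewrite mulrSr addrK.
by rewrite (mulrSr t k.+1) cosB cosD; ring.
Qed.

Lemma cox_polyP n : (0 < n)%N ->
  is_minpoly (cos_sqr4 n) (map_poly intr (cox_poly n)).
Proof.
case: n => // n _; rewrite /cox_poly.
apply: (@xgetPex _ 0 [set p : {poly int} | is_minpoly _ (map_poly intr p)]%classic).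
have [_ gm gs ev] := chebyshev_pairP n.
set g := (chebyshev_pair n).2 in gm gs ev.
have c2 : (size (- 2%:P : {poly int}) < size g)%N.
  by rewrite size_polyN gs (leq_ltn_trans (size_polyC_leq1 _)).
have hm : g - 2%:P \is monic by rewrite monicE lead_coefDl //; exact/monicP.
apply: (@minpoly_int_ex _ ((g - 2%:P) \Po ('X - 2%:P))).
  rewrite monicE lead_coef_comp ?size_XsubC // lead_coefXsubC expr1n mulr1.
  exact/eqP/monicP.
rewrite map_comp_poly /root horner_comp !rmorphB /= map_polyX !map_polyC /=.
rewrite hornerXsubC.
have -> : cos_sqr4 n.+1 - 2 = 2 * cos (pi / n.+1%:R *+ 2).
  by rewrite cos_mulr2n /cos_sqr4 mulr2n; ring.
rewrite hornerD hornerN hornerC (ev _).2 -mulrnAC -[_ / _ *+ _]mulr_natr.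
by rewrite mulrVK ?unitfE ?pnatr_eq0 // cos2pi mulr1 subrr.
Qed.

Section QuotientRing.
Variables (I : choiceType) (m : coxeterMatrix I).

(** Evaluation of [p] at [x] in a corner ring whose identity is [e]. *)
Definition corner_horner (e x : pathAlg m) (p : {poly int}) : pathAlg m :=
  \sum_(k < size p) p`_k *: iter k (pmul x) e.

Definition cox_relator (n : nat) i j (e : edge m i j) (e' : edge m j i) :
    pathAlg m :=
  corner_horner (idem m i) (pmul (edge_elt e) (edge_elt e')) (cox_poly n).

Inductive in_cox_ideal : pathAlg m -> Prop :=
| cox_ideal_gen n i j (e : edge m i j) (e' : edge m j i) :
    m i j = Some n -> in_cox_ideal (cox_relator n e e')
| cox_ideal0 : in_cox_ideal 0
| cox_idealB x y : in_cox_ideal x -> in_cox_ideal y -> in_cox_ideal (x - y)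
| cox_idealMl a x : in_cox_ideal x -> in_cox_ideal (pmul a x)
| cox_idealMr a x : in_cox_ideal x -> in_cox_ideal (pmul x a).

Definition cox_ideal : pathAlg m -> bool := fun x => `[< in_cox_ideal x >].

Lemma cox_ideal_zmod_closed : zmod_closed cox_ideal.
Proof.
split=> [|x y /asboolP xI /asboolP yI]; apply/asboolP.
  exact: cox_ideal0.
exact: cox_idealB.
Qed.

HB.instance Definition _ :=
  GRing.isZmodClosed.Build (pathAlg m) cox_ideal cox_ideal_zmod_closed.

Definition coxRing := Quotient.quot (GRing.ZmodClosed.clone _ cox_ideal _).
HB.instance Definition _ := GRing.Zmodule.on coxRing.

Definition toCox (x : pathAlg m) : coxRing := \pi_coxRing x.

Definition cmul (x y : coxRing) : coxRing := toCox (pmul (repr x) (repr y)).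

Lemma toCox_eq x y : toCox x = toCox y <-> in_cox_ideal (x - y).
Proof.
split=> [/eqP|xy]; last apply/eqP.
  by rewrite /toCox -Quotient.idealrBE => /asboolP.
by rewrite /toCox -Quotient.idealrBE; apply/asboolP.
Qed.

Lemma cmul_toCox x y : cmul (toCox x) (toCox y) = toCox (pmul x y).
Proof.
set x' := repr (toCox x); set y' := repr (toCox y).
have xI : in_cox_ideal (x' - x) by apply/toCox_eq; exact: reprK.
have yI : in_cox_ideal (y' - y) by apply/toCox_eq; exact: reprK.
apply/toCox_eq; rewrite -/x' -/y'.
rewrite -[_ - _](subrKA (pmul x y')) -pmulBl -pmulBr.
rewrite -[pmul x _]opprK -[- pmul _ _]sub0r.
by do !apply: cox_idealB; [exact: cox_idealMr|exact: cox_ideal0|exact: cox_idealMl].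
Qed.

(** Membership in the corner of [coxRing] cut out by the idempotents of [i] and
    [j]. *)
Definition in_corner (i j : I) (x : coxRing) : Prop :=
  exists r : coxRing, x = cmul (cmul (toCox (idem m i)) r) (toCox (idem m j)).

End QuotientRing.

(* Main.v *)
From HB Require Import structures.
Require Import Defs.
From mathcomp Require Import all_boot all_order all_algebra finmap zify.
From mathcomp Require Import boolp classical_sets reals Rstruct trigo.
From mathcomp.multinomials Require Import monalg.

(** The edge [{a, b}] generates inside [coxRing] a copy of the order
    [Z[t] / (C_m)], or of [Z[t]] for an infinite label, extended by [T] with
    [T ^ 2 = t] for the passages between [a] and [b]. The ring is a coproduct of
    these edge rings over the vertices: it acts on the free module on reduced words
    in the powers [T ^ n] along edges (consecutive letters along distinct edges),
    and the corner from [i] to [k] is free on the reduced words from [i] to [k].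

    To see that [x * y = 0] forces [x = 0] or [y = 0], induct on the maximal number
    of letters in the words of [x]. Take a longest word of [y], with first letter
    along the edge [f], and let [q] be its tail; delete the last letters along [f]
    from the words of [x] and let [p] be a longest word so obtained. In [x] and [y]
    the words that extend [p] and [q] by a letter along [f] form [p * v] and
    [u * q], where [v] and [u] lie in the edge ring of [f], and the coefficients of
    [x * y] at the words [p * w * q] are those of [v * u] at the letters [w]. They
    vanish, so [v * u] is an integer [c], nonzero since the edge ring is a domain;
    likewise for every other word as long as [p]. Hence [x * u] has shorter words,
    [(x * u) * (v * y) = c * (x * y) = 0], and both factors are nonzero since
    [u * v = c]. *)

Set Implicit Arguments.
Unset Strict Implicit.
Unset Printing Implicit Defensive.

Import Order.TTheory GRing.Theory Num.Theory.
Local Open Scope ring_scope.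
Local Open Scope quotient_scope.

(** * Linear extension *)

Section LinearExtension.
Variables (K : choiceType) (V : zmodType).
Implicit Types (f g : K -> V) (x y : {malg int[K]}).

Definition lin f x : V := \sum_(k <- msupp x) f k *~ x@_k.

Lemma linE (d : {fset K}) f x : (msupp x `<=` d)%fset ->
  lin f x = \sum_(k <- d) f k *~ x@_k.
Proof.
move=> le; rewrite /lin (big_fset_incl _ le) // => k _ /mcoeff_outdom ->.
by rewrite mulr0z.
Qed.

Lemma lin_is_additive f : zmod_morphism (lin f).
Proof.
move=> x y; pose d := (msupp x `|` msupp y)%fset.
rewrite (@linE d) ?msuppB_le // (@linE d f x) ?fsubsetUl //.
rewrite (@linE d f y) ?fsubsetUr // -sumrB; apply: eq_bigr => k _.
by rewrite mcoeffB mulrzBr.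
Qed.
HB.instance Definition _ f :=
  GRing.isZmodMorphism.Build {malg int[K]} V (lin f) (lin_is_additive f).

Lemma linU f k : lin f << k >> = f k.
Proof. by rewrite /lin msuppU oner_eq0 big_seq_fset1 mcoeffUU. Qed.

Lemma eq_lin f g x : {in msupp x, f =1 g} -> lin f x = lin g x.
Proof. by move=> fg; apply: eq_big_seq => k /fg ->. Qed.


Lemma lin_f0 x : lin (fun=> 0) x = 0.
Proof. by rewrite /lin big1 // => k _; rewrite mul0rz. Qed.

Lemma lin_fB f g x : lin (fun k => f k - g k) x = lin f x - lin g x.
Proof. by rewrite /lin -sumrB; apply: eq_bigr => k _; rewrite mulrzBl. Qed.

End LinearExtension.

Lemma malg_lin (K : choiceType) (x : {malg int[K]}) : lin (fun k => << k >>) x = x.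
Proof.
rewrite [RHS]monalgE /lin; apply: eq_bigr => k _.
by rewrite -(raddfMz (mkmalgU k)) intz.
Qed.

Lemma raddf_lin (K : choiceType) (V W : zmodType) (h : {additive V -> W})
    (f : K -> V) x : h (lin f x) = lin (h \o f) x.
Proof. by rewrite /lin raddf_sum; apply: eq_bigr => k _; rewrite raddfMz. Qed.

(** Agreement is required on the support only, since most identities below hold only for words that
    satisfy [good]. *)
Lemma malg_span (K : choiceType) (V : zmodType) (g h : {additive {malg int[K]} -> V})
    x : {in msupp x, forall k, g << k >> = h << k >>} -> g x = h x.
Proof. by move=> gh; rewrite -[x]malg_lin !raddf_lin; apply: eq_lin. Qed.

Lemma lin_mcoeff (K L : choiceType) (f : K -> {malg int[L]}) x l :
  (lin f x)@_l = lin (fun k => (f k)@_l) x.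
Proof. by rewrite (raddf_lin (mcoeff l)). Qed.

Lemma lin_msupp (K L : choiceType) (f : K -> {malg int[L]}) x l :
  l \in msupp (lin f x) -> exists2 k, k \in msupp x & l \in msupp (f k).
Proof.
rewrite -mcoeff_neq0 => xl.
have [//|no] := pselect (exists2 k, k \in msupp x & l \in msupp (f k)).
case/eqP: xl; rewrite lin_mcoeff /lin big_seq big1 // => k kx.
rewrite (_ : (f k)@_l = 0) ?mul0rz //; apply/eqP; rewrite mcoeff_eq0.
by apply/negP => lk; apply: no; exists k.
Qed.

(** * Additive maps out of integer polynomials *)

Section PolyExtension.
Variable V : zmodType.
Implicit Types (g : nat -> V) (f : {poly int}).

(** For [g r = iter r T v] this is the polynomial [f] in the operator [T], applied to [v]. *)
Definition plin g f : V := \sum_(l < size f) g l *~ f`_l.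

Lemma plinE n g f : (size f <= n)%N -> plin g f = \sum_(l < n) g l *~ f`_l.
Proof.
move=> le; rewrite /plin (big_ord_widen n (fun l => g l *~ f`_l)) //.
rewrite [RHS](bigID (fun l : 'I_n => (l < size f)%N)) /= [X in _ + X]big1 ?addr0 //.
by move=> l; rewrite -leqNgt => /(nth_default 0) ->; rewrite mulr0z.
Qed.

Lemma plin_is_additive g : zmod_morphism (plin g).
Proof.
move=> x y; pose n := maxn (size x) (size y).
rewrite (@plinE n); last by rewrite (leq_trans (size_polyD _ _)) ?size_polyN.
rewrite (@plinE n g x) ?leq_maxl // (@plinE n g y) ?leq_maxr // -sumrB.
by apply: eq_bigr => l _; rewrite coefB mulrzBr.
Qed.
HB.instance Definition _ g :=
  GRing.isZmodMorphism.Build {poly int} V (plin g) (plin_is_additive g).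

Lemma plinXn g n : plin g 'X^n = g n.
Proof.
rewrite /plin size_polyXn big_ord_recr /= big1 => [|l _].
  by rewrite add0r coefXn eqxx.
by rewrite coefXn ltn_eqF ?ltn_ord // mulr0z.
Qed.

Lemma eq_plin g h f : (forall l, f`_l != 0 -> g l = h l) -> plin g f = plin h f.
Proof.
move=> gh; apply: eq_bigr => l _.
by have [->|/gh ->//] := eqVneq f`_l 0; rewrite !mulr0z.
Qed.

End PolyExtension.

Lemma raddf_plin (V W : zmodType) (h : {additive V -> W}) (g : nat -> V) f :
  h (plin g f) = plin (h \o g) f.
Proof. by rewrite /plin raddf_sum; apply: eq_bigr => k _; rewrite raddfMz. Qed.

Lemma poly_plin (f : {poly int}) : plin (fun l => 'X^l) f = f.
Proof.
rewrite /plin -[RHS]coefK poly_def; apply: eq_bigr => l _.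
by rewrite -scaler_int intz.
Qed.

Lemma poly_span (V : zmodType) (g h : {additive {poly int} -> V}) (f : {poly int}) :
  (forall l, f`_l != 0 -> g 'X^l = h 'X^l) -> g f = h f.
Proof. by move=> gh; rewrite -[f]poly_plin !raddf_plin; apply: eq_plin. Qed.

Lemma plin_msupp (K : choiceType) (g : nat -> {malg int[K]}) (f : {poly int}) k :
  k \in msupp (plin g f) -> exists2 l, f`_l != 0 & k \in msupp (g l).
Proof.
rewrite -mcoeff_neq0 => xl.
have [//|no] := pselect (exists2 l, f`_l != 0 & k \in msupp (g l)).
case/eqP: xl; rewrite (raddf_plin (mcoeff k)) /plin big1 // => l _ /=.
have [->|fl] := eqVneq f`_l 0; first by rewrite mulr0z.
rewrite (_ : (g l)@_k = 0) ?mul0rz //; apply/eqP; rewrite mcoeff_eq0.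
by apply/negP => lk; apply: no; exists l.
Qed.

Lemma plin_f0 (V : zmodType) (f : {poly int}) : plin (fun=> 0 : V) f = 0.
Proof. by rewrite /plin big1 // => l _; rewrite mul0rz. Qed.

Lemma plin_delta (f : {poly int}) n : plin (fun l => (l == n)%:R) f = f`_n.
Proof.
rewrite -[RHS]/(coefp n f) -[f in RHS]poly_plin (raddf_plin (coefp n)); apply: eq_plin => l _ /=.
by rewrite coefXn eq_sym.
Qed.

(** * Edge rings *)

Lemma cox_poly_monic n : (0 < n)%N -> cox_poly n \is monic.
Proof.
case/cox_polyP=> mon _ _; move: mon.
rewrite !monicE lead_coef_map_inj ?rmorph0 //; last exact: intr_inj.
by rewrite -(rmorph1 (intr : int -> rat)) (inj_eq intr_inj).
Qed.

Lemma map_intr_ratr (F : numFieldType) (p : {poly int}) :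
  map_poly (ratr : rat -> F) (map_poly intr p) = map_poly intr p.
Proof. by rewrite -map_poly_comp; apply: eq_map_poly => a /=; rewrite ratr_int. Qed.

Lemma root_cox_poly n : (0 < n)%N -> root (map_poly intr (cox_poly n)) (cos_sqr4 n).
Proof. by case/cox_polyP=> _; rewrite map_intr_ratr. Qed.

Lemma size_cox_poly_gt1 n : (0 < n)%N -> (1 < size (cox_poly n))%N.
Proof.
move=> n0; have mon := cox_poly_monic n0; have rt := root_cox_poly n0.
rewrite ltnNge; apply/negP => /size1_polyC C1.
move: mon rt; rewrite C1 monicE lead_coefC => /eqP ->.
by rewrite map_polyC /= rootC oner_eq0.
Qed.

Section EdgeRing.
Variables (I : choiceType) (m : coxeterMatrix I).
Implicit Types (i j : I) (f g : {poly int}).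

(** [0] for infinite labels: [rmodp] by [0] is the identity. *)
Definition edge_poly i j : {poly int} := if m i j is Some n then cox_poly n else 0.

(** Normal form in the edge ring. The coefficients are integers, so the division relies on
    [cox_poly] being monic. *)
Definition edge_rem i j f : {poly int} := Pdiv.Ring.rmodp f (edge_poly i j).

Lemma edge_poly_sym i j : edge_poly i j = edge_poly j i.
Proof. by rewrite /edge_poly cox_ord_sym. Qed.

Lemma rem_sym i j : edge_rem i j =1 edge_rem j i.
Proof. by move=> f; rewrite /edge_rem edge_poly_sym. Qed.

Section Label.
Variables i j : I.

Lemma label_gt0 n : m i j = Some n -> (0 < n)%N.
Proof.
have [->|ij mij] := eqVneq i j; first by rewrite cox_ord_diag => -[<-].
by apply: ltn_trans (cox_ord_ge2 ij mij).
Qed.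

Variant edge_poly_spec : {poly int} -> Prop :=
| EdgePolyInf : edge_poly_spec 0
| EdgePolyFin n of cox_poly n \is monic & (1 < size (cox_poly n))%N :
    edge_poly_spec (cox_poly n).

Lemma edge_polyP : edge_poly_spec (edge_poly i j).
Proof.
rewrite /edge_poly; case mij: (m i j) => [n|]; last by constructor.
have n0 := label_gt0 mij.
by apply: EdgePolyFin; [exact: cox_poly_monic|exact: size_cox_poly_gt1].
Qed.

Lemma rem_is_additive : zmod_morphism (edge_rem i j).
Proof.
move=> f g; rewrite /edge_rem; case: edge_polyP => [|n mon _].
  by rewrite !Pdiv.Ring.rmodp0.
by rewrite Pdiv.RingMonic.rmodpD // Pdiv.RingMonic.rmodpN.
Qed.

HB.instance Definition _ :=
  GRing.isZmodMorphism.Build {poly int} {poly int} (edge_rem i j) rem_is_additive.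

Lemma rem_mulr f g : edge_rem i j (f * edge_rem i j g) = edge_rem i j (f * g).
Proof.
rewrite /edge_rem; case: edge_polyP => [|n mon _]; first by rewrite !Pdiv.Ring.rmodp0.
exact: Pdiv.RingMonic.rmodp_mulmr.
Qed.

Lemma rem_id f : edge_rem i j (edge_rem i j f) = edge_rem i j f.
Proof. by have := rem_mulr 1 f; rewrite !mul1r. Qed.

Lemma rem1 : edge_rem i j 1 = 1.
Proof.
rewrite /edge_rem; case: edge_polyP => [|n mon sz]; first by rewrite !Pdiv.Ring.rmodp0.
by rewrite Pdiv.Ring.rmodp_small // size_poly1.
Qed.

(** Being reduced is a degree bound for a finite label and no condition for an infinite one, so
    every monomial of a remainder is reduced. *)
Lemma remXn_coef f l : (edge_rem i j f)`_l != 0 -> edge_rem i j 'X^l = 'X^l.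
Proof.
rewrite /edge_rem; case: edge_polyP => [|n mon sz]; first by rewrite !Pdiv.Ring.rmodp0.
move=> fl; rewrite Pdiv.Ring.rmodp_small // size_polyXn.
apply: (@leq_trans (size (Pdiv.Ring.rmodp f (cox_poly n))).+1); last first.
  by rewrite Pdiv.Ring.ltn_rmodp monic_neq0.
by rewrite ltnS ltnNge; apply: contra_neqN fl => /(nth_default 0).
Qed.

Lemma rem_coxM n f : m i j = Some n -> edge_rem i j (f * cox_poly n) = 0.
Proof.
move=> mij; rewrite /edge_rem /edge_poly mij; apply: Pdiv.RingMonic.rmodp_mull.
exact: cox_poly_monic (label_gt0 mij).
Qed.

(** [pi / n] lies strictly between [0] and [pi / 2], where the cosine is positive. The bound is
    sharp: the value is [0] for [n = 2]. *)
Lemma cos_sqr4_neq0 n : (2 < n)%N -> cos_sqr4 n != 0.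
Proof.
move=> n2; rewrite /cos_sqr4 mulf_neq0 ?expf_neq0 ?pnatr_eq0 //.
apply/lt0r_neq0/cos_gt0_pihalf.
have n0 : (0 : Rdefinitions.R) < n%:R by rewrite ltr0n; apply: leq_trans n2.
have p0 := @pi_gt0 Rdefinitions.R.
apply/andP; split.
  by apply: (@lt_trans _ _ 0); [rewrite oppr_lt0 divr_gt0|rewrite divr_gt0].
by rewrite ltr_pM2l // ltf_pV2 ?posrE // ltr_nat.
Qed.

(** As [cox_poly n] is the minimal polynomial of [cos_sqr4 n], evaluation there embeds the edge ring
    into the reals. *)
Lemma rem_eq0_cos n f : m i j = Some n ->
  (edge_rem i j f == 0) = root (map_poly intr f) (cos_sqr4 n).
Proof.
move=> mij; have n0 := label_gt0 mij.
rewrite /edge_rem /edge_poly mij; have mon := cox_poly_monic n0.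
have [_ _ min] := cox_polyP n0; have /eqP rt := root_cox_poly n0.
rewrite {2}(Pdiv.RingMonic.rdivp_eq mon f) rmorphD rmorphM /root hornerD hornerM rt.
rewrite mulr0 add0r; apply/eqP/eqP => [->|r0]; first by rewrite rmorph0 horner0.
(* A nonzero remainder with this root would have smaller degree than the minimal polynomial. *)
apply: contraTeq (erefl true) => rN0; rewrite -(monic_neq0 mon).
rewrite -(Pdiv.Ring.ltn_rmodp f) -leqNgt -(size_rat_int_poly (cox_poly n)).
rewrite -size_rat_int_poly.
apply: min; first by rewrite map_poly_eq0_id0 // intr_eq0 lead_coef_eq0.
by rewrite map_intr_ratr; apply/eqP.
Qed.

(** [cox_poly] is prime, and it does not divide ['X]. *)
Lemma rem_integral f g b : edge m i j ->
  edge_rem i j ('X^b * f * g) = 0 -> edge_rem i j f = 0 \/ edge_rem i j g = 0.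
Proof.
case/andP=> _; case mij: (m i j) => [n|] n3; last first.
  rewrite /edge_rem /edge_poly mij !Pdiv.Ring.rmodp0 => /eqP.
  by rewrite !mulf_eq0 expf_eq0 polyX_eq0 andbF /= => /orP[]/eqP; [left|right].
move=> /eqP; rewrite (rem_eq0_cos _ mij) !rmorphM /= map_polyXn !rootM -!(rem_eq0_cos _ mij).
rewrite -orbA => /or3P[|/eqP|/eqP]; [|by left|by right].
rewrite /root hornerXn expf_eq0 (negPf (cos_sqr4_neq0 n3)).
by rewrite andbF.
Qed.

End Label.
End EdgeRing.

(** * Reduced words *)

Section Words.
Variables (I : choiceType) (m : coxeterMatrix I).

(** [(a, b, e, n)] encodes the alternating path of length [2 * n + e] that starts
    at [a] and runs along the edge between [a] and [b]. *)
Definition letter : Type := (I * I * bool * nat)%type.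
HB.instance Definition _ := Choice.on letter.
Definition word : Type := seq letter.
HB.instance Definition _ := Choice.on word.
Implicit Types (i j k a b c d : I) (l : letter) (p q s t w : word).

Definition fst_vertex l : I := l.1.1.1.
Definition snd_vertex l : I := l.1.1.2.
Definition end_vertex l : I := if l.1.2 then l.1.1.2 else l.1.1.1.

Definition on_edge i j l : bool :=
  ((fst_vertex l == i) && (snd_vertex l == j))
  || ((fst_vertex l == j) && (snd_vertex l == i)).

(** The last condition keeps the exponent below the degree of [cox_poly], and is void for an
    infinite label. *)
Definition letter_ok l : bool :=
  [&& edge m (fst_vertex l) (snd_vertex l), l.1.2 || (0 < l.2)%N &
      edge_rem m (fst_vertex l) (snd_vertex l) 'X^(l.2) == 'X^(l.2)].

Definition lfree i j w : bool := if w is l :: _ then ~~ on_edge i j l else true.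
Definition rfree i j w : bool := lfree i j (rev w).

(** These are the reduced words from [i] to [k]. The empty word serves every vertex and records
    none, so both ends are parameters. *)
Fixpoint good k i w : bool :=
  if w is l :: w' then
    [&& fst_vertex l == i, letter_ok l, lfree (fst_vertex l) (snd_vertex l) w' &
        good k (end_vertex l) w']
  else i == k.

(** [T ^ 0] is not a letter. *)
Definition wcons i j (e : bool) n w : word :=
  if e || (0 < n)%N then (i, j, e, n) :: w else w.

Lemma on_edge_sym i j l : on_edge i j l = on_edge j i l.
Proof. by rewrite /on_edge orbC. Qed.

Lemma lfree_sym i j w : lfree i j w = lfree j i w.
Proof. by case: w => //= l w; rewrite on_edge_sym. Qed.

Lemma on_edgeC l l' :
  on_edge (fst_vertex l) (snd_vertex l) l' = on_edge (fst_vertex l') (snd_vertex l') l.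
Proof.
rewrite /on_edge !(eq_sym (fst_vertex l)) !(eq_sym (snd_vertex l)).
by congr (_ || _); rewrite andbC.
Qed.

Lemma edge_neq i j : edge m i j -> i != j.
Proof. by case/andP. Qed.

Lemma good_inj k i j w : good k i w -> good k j w -> i = j.
Proof.
by case: w => [/eqP-> /eqP->|l w /= /and4P[/eqP<- _ _ _] /and4P[/eqP<- _ _ _]].
Qed.

Lemma rfree_rcons i j p l : rfree i j (rcons p l) = ~~ on_edge i j l.
Proof. by rewrite /rfree rev_rcons. Qed.

Lemma rfree_cons2 i j p l l' : rfree i j (l :: l' :: p) = rfree i j (l' :: p).
Proof. by rewrite /rfree !rev_cons; case: (rev p). Qed.

Lemma good_cat k i p l q : good k i (p ++ l :: q) =
  [&& good (fst_vertex l) i p, rfree (fst_vertex l) (snd_vertex l) p &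
      good k (fst_vertex l) (l :: q)].
Proof.
elim: p i => [|l0 p IH] i; first by rewrite /= eqxx [i == _]eq_sym.
rewrite [LHS]/= IH /=; case: p IH => [|l1 p] _ /=.
  rewrite /rfree /= on_edgeC eqxx /= -!andbA; do !bool_congr.
by rewrite rfree_cons2 -!andbA.
Qed.

(** The power of [T] that is split off may be [T ^ 0], so one form covers the words that start along
    the edge and those that do not. *)
Variant lsplit_spec k i j : word -> Prop :=
  LSplit e n w of edge_rem m i j 'X^n = 'X^n & lfree i j w
    & good k (if e then j else i) w : lsplit_spec k i j (wcons i j e n w).

Lemma lsplitP k i j w : edge m i j -> good k i w -> lsplit_spec k i j w.
Proof.
move=> eij; case: w => [|l w gw].
  by move=> gi; rewrite -[[::]]/(wcons i j false 0 [::]); split; rewrite ?rem1.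
case lij: (on_edge i j l); last first.
  by rewrite -[_ :: _]/(wcons i j false 0 (l :: w)); split; rewrite ?rem1 //= lij.
move: gw => /= /and4P[/eqP li /and3P[el pos /eqP red] fr gw].
have lj : snd_vertex l = j.
  case/orP: lij => /andP[/eqP la /eqP lb] //.
  by case/negP: (edge_neq eij); rewrite -li la.
case: l {lij el} => [[[a b] e] n] /= in li lj pos red fr gw *.
rewrite /fst_vertex /snd_vertex /end_vertex /= in li lj red fr gw *; subst a b.
by have -> : (i, j, e, n) :: w = wcons i j e n w by rewrite /wcons pos.
Qed.

(** The mirror image at the right end: the power split off ends at [j], so its parity [e] decides
    whether it starts at [b] or at [j]. *)
Variant rsplit_spec j b i : word -> Prop :=
  RSplit e n w of edge_rem m j b 'X^n = 'X^n & rfree j b w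
    & good (if e then b else j) i w :
    rsplit_spec j b i (w ++ wcons (if e then b else j) (if e then j else b) e n [::]).

Lemma rsplitP j b i w : edge m j b -> good j i w -> rsplit_spec j b i w.
Proof.
move=> ejb; case/lastP: w => [|w l gw].
  by move=> gi; apply: (@RSplit _ _ _ false 0 [::]); rewrite ?rem1.
case lij: (on_edge j b l); last first.
  rewrite -[rcons w l]cats0.
  by apply: (@RSplit _ _ _ false 0) => //; rewrite ?rem1 ?rfree_rcons ?lij.
move: gw; rewrite -cats1 good_cat => /and3P[gw fr].
case: l lij fr gw => [[[a c] e] n].
rewrite /= /letter_ok /on_edge /fst_vertex /snd_vertex /end_vertex /= eqxx /=.
move=> lij fr gw /andP[/and3P[_ pos /eqP red] /eqP ej].
have [ea ec] : a = (if e then b else j) /\ c = (if e then j else b).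
  have nb := negPf (edge_neq ejb).
  case: e ej lij {pos red} => ->; rewrite nb eqxx /= ?andbF ?andbT ?orbF => /eqP->;
    by split.
have <- : wcons a c e n [::] = [:: (a, c, e, n)] by rewrite /wcons pos.
rewrite ea ec in red fr gw *; apply: RSplit => //.
- by case: (e) red => //; rewrite (rem_sym m b j).
- by case: (e) fr => //; rewrite /rfree lfree_sym.
Qed.

Lemma good_wcons k i j e n w : edge m i j -> edge_rem m i j 'X^n = 'X^n -> lfree i j w ->
  good k (if e then j else i) w -> good k i (wcons i j e n w).
Proof.
rewrite /wcons => eij red fr gw; case: ifP => [pos|].
  by rewrite /= /letter_ok eqxx eij pos red eqxx fr.
by case: e gw.
Qed.

Lemma size_wcons i j e n w : (size w <= size (wcons i j e n w) <= (size w).+1)%N.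
Proof. by rewrite /wcons; case: ifP => _ /=; rewrite leqnSn leqnn. Qed.

End Words.

(** * The action of edges on words *)

Section Syllables.
Variables (I : choiceType) (m : coxeterMatrix I).
Local Notation word := (word I).
Local Notation wmod := {malg int[word]}.
Implicit Types (i j k a b c d : I) (l : letter I) (p q s t w : word) (z : wmod).

(** The product of [f (T ^ 2) * T ^ e], along the edge from [i] to [j], and [w]. *)
Definition put i j e w (f : {poly int}) : wmod := plin (fun n => << wcons i j e n w >>) f.

(** Left multiplication by [T]. An odd first letter along the same edge becomes an even power with
    exponent [n + 1], which may reach the degree of [cox_poly], hence the reduction; an even one
    only changes parity. *)
Definition push_edge i j w : wmod :=
  if w is (a, b, e, n) :: w' then
    if (a == j) && (b == i) then
      if e then put i j false w' (edge_rem m i j 'X^(n.+1)) else << (i, j, true, n) :: w' >>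
    else << (i, j, true, 0%N) :: w >>
  else << [:: (i, j, true, 0%N)] >>.

Definition word_act i j : wmod -> wmod := lin (push_edge i j).
HB.instance Definition _ i j :=
  GRing.isZmodMorphism.Build wmod wmod (word_act i j) (lin_is_additive _).

Section Operators.
Variables (V : zmodType) (Y : I -> I -> {additive V -> V}).

(** The family [Y] is arbitrary because two are needed: [word_act] on words and [edge_mul] on the
    quotient ring. *)
Definition letter_op l (v : V) : V :=
  let: (a, b, e, n) := l in
  iter n (fun v => Y a b (Y b a v)) (if e then Y a b v else v).

Definition word_op w v := foldr letter_op v w.

Fixpoint path_op i (s : seq I) v : V := if s is j :: s' then Y i j (path_op j s' v) else v.

(** For [Y = word_act] this is the product of combinations of words; for [Y = edge_mul] it evaluates
    words in [coxRing]. *)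
Definition star (x : wmod) v := lin (word_op^~ v) x.

Lemma iter_additive n (T : {additive V -> V}) : zmod_morphism (iter n T).
Proof. by elim: n => //= n IH x y /=; rewrite IH raddfB. Qed.

Lemma letter_op_is_additive l : zmod_morphism (letter_op l).
Proof.
case: l => [[[a b] e] n] x y /=; elim: n => /= [|n ->]; last by rewrite !raddfB.
by case: e; rewrite ?raddfB.
Qed.
HB.instance Definition _ l :=
  GRing.isZmodMorphism.Build V V (letter_op l) (letter_op_is_additive l).

Lemma word_op_is_additive w : zmod_morphism (word_op w).
Proof. by elim: w => //= l w IH x y /=; rewrite IH raddfB. Qed.
HB.instance Definition _ w := GRing.isZmodMorphism.Build V V (word_op w) (word_op_is_additive w).

Lemma star_is_additive x : zmod_morphism (star x).
Proof.
by move=> u v; rewrite /star -lin_fB; apply: eq_lin => w _; rewrite raddfB.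
Qed.
HB.instance Definition _ x := GRing.isZmodMorphism.Build V V (star x) (star_is_additive x).

Definition star_at v x := star x v.

Lemma star_at_is_additive v : zmod_morphism (star_at v).
Proof. by move=> x y; rewrite /star_at /star raddfB. Qed.
HB.instance Definition _ v := GRing.isZmodMorphism.Build wmod V (star_at v) (star_at_is_additive v).

Lemma starU w v : star << w >> v = word_op w v.
Proof. by rewrite /star linU. Qed.

Lemma word_op_cat p q v : word_op (p ++ q) v = word_op p (word_op q v).
Proof. by rewrite /word_op foldr_cat. Qed.

Definition edge_loop i j v := Y i j (Y j i v).

Lemma iter_edge_loop n i j v :
  iter n (edge_loop i j) (Y i j v) = Y i j (iter n (edge_loop j i) v).
Proof. by elim: n => //= n ->. Qed.

End Operators.

Definition fits k i z := forall w, w \in msupp z -> good m k i w.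

Lemma fits_lin (K : choiceType) (f : K -> wmod) x k i :
  (forall u, u \in msupp x -> fits k i (f u)) -> fits k i (lin f x).
Proof. by move=> fx w /lin_msupp[u ux]; apply: fx. Qed.

Lemma fitsU k i w : good m k i w -> fits k i << w >>.
Proof. by move=> gw w'; rewrite msuppU oner_eq0 inE => /eqP->. Qed.

Lemma fits_put k i j e (f : {poly int}) w : edge m i j -> edge_rem m i j f = f ->
  lfree i j w -> good m k (if e then j else i) w -> fits k i (put i j e w f).
Proof.
move=> eij rf fr gw w' /plin_msupp[n fn].
rewrite msuppU oner_eq0 inE => /eqP->; apply: good_wcons => //.
by apply: (remXn_coef (f := f)); rewrite rf.
Qed.

Lemma put_is_additive i j e w : zmod_morphism (put i j e w).
Proof. by move=> f g; rewrite /put raddfB. Qed.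
HB.instance Definition _ i j e w :=
  GRing.isZmodMorphism.Build {poly int} wmod (put i j e w) (put_is_additive i j e w).

Lemma putXn i j e n w : put i j e w 'X^n = << wcons i j e n w >>.
Proof. by rewrite /put plinXn. Qed.

Lemma put1 i j w : put i j false w 1 = << w >>.
Proof. exact: (putXn i j false 0 w). Qed.

(** [T * T ^ (2 * n + e)] has the opposite parity, and an odd [e] carries over into one more factor
    [t = T ^ 2]. *)
Lemma word_act_wcons i j e n w : edge m i j -> lfree i j w -> edge_rem m i j 'X^n = 'X^n ->
  word_act i j << wcons j i e n w >> = put i j (~~ e) w (edge_rem m i j ('X^e * 'X^n)).
Proof.
move=> eij fr red; rewrite /word_act linU /wcons; case: e => /=.
  by rewrite !eqxx -exprD add1n.
rewrite -exprD add0n red putXn /wcons /=.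
(* For [n = 0] the letter is absent, and by [lfree] the word [w] offers none along this edge to
   merge with. *)
case: posnP => [->|_]; last by rewrite /= !eqxx.
case: w fr => [|[[[a b] e] n'] w] //=.
by rewrite /on_edge /fst_vertex /snd_vertex => /norP[_ /negPf ->].
Qed.

Lemma word_act_put i j e (f : {poly int}) w : edge m i j -> lfree i j w ->
  edge_rem m i j f = f ->
  word_act i j (put j i e w f) = put i j (~~ e) w (edge_rem m i j ('X^e * f)).
Proof.
move=> eij fr red.
pose g : {additive {poly int} -> wmod} := word_act i j \o put j i e w.
pose h : {additive {poly int} -> wmod} := put i j (~~ e) w \o (edge_rem m i j \o ('X^e \*o idfun)).
rewrite -[LHS]/(g f) -[RHS]/(h f); apply: poly_span => n fn; rewrite /g /h /=.
rewrite putXn word_act_wcons //.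
by apply: (remXn_coef (f := f)); rewrite red.
Qed.

Lemma iter_loop_put i j e (f : {poly int}) n w : edge m i j -> lfree i j w ->
  edge_rem m i j f = f ->
  iter n (edge_loop word_act i j) (put i j e w f) = put i j e w (edge_rem m i j ('X^n * f)).
Proof.
move=> eij fr red; elim: n => [|n /= ->]; first by rewrite mul1r red.
have eji : edge m j i by rewrite edge_sym.
have fr' : lfree j i w by rewrite lfree_sym.
rewrite /edge_loop /= word_act_put //; last by rewrite rem_sym rem_id.
rewrite word_act_put //; last by rewrite rem_sym rem_id.
rewrite negbK (rem_sym m j i) rem_mulr !mulrA -exprD rem_mulr mulrA -exprD.
by case: e.
Qed.

(** Lengths add with a carry: two odd parities produce one more factor [t]. The pair [(c, d)] is the
    edge read from the end of the letter. *)
Lemma letter_op_put a b e n c d e' (f : {poly int}) w :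
  c = (if e then b else a) -> d = (if e then a else b) ->
  edge m a b -> lfree a b w -> edge_rem m a b f = f ->
  letter_op word_act (a, b, e, n) (put c d e' w f) =
  put a b (e (+) e') w (edge_rem m a b ('X^(n + (e && e')) * f)).
Proof.
move=> -> -> eab fr red; rewrite /letter_op; case: e => /=.
  rewrite word_act_put // -/(edge_loop _ _ _) iter_loop_put ?rem_id //.
  by rewrite rem_mulr mulrA -exprD.
by rewrite addn0 iter_loop_put.
Qed.

Lemma fits_word_act k i j z : edge m i j -> fits k j z -> fits k i (word_act i j z).
Proof.
move=> eij fz; apply: fits_lin => w /fz gw.
have eji : edge m j i by rewrite edge_sym.
have [e n w' red fr gw'] := lsplitP eji gw.
rewrite -/(push_edge i j _) -(linU (push_edge i j)) -/(word_act i j _).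
rewrite word_act_wcons // 1?lfree_sym // 1?rem_sym //.
apply: fits_put => //; first by rewrite rem_sym rem_id.
  by rewrite lfree_sym.
by case: (e) gw'.
Qed.

(** Once the first power of [T] is split off, the loop from [i] through [j] multiplies by [t] in the
    edge ring, where [cox_poly n] is zero. *)
Lemma word_act_relation k i j n z : m i j = Some n -> edge m i j -> fits k i z ->
  plin (fun r => iter r (edge_loop word_act i j) z) (cox_poly n) = 0.
Proof.
move=> mij eij fz.
pose T r : {additive wmod -> wmod} :=
  HB.pack (iter r (edge_loop word_act i j))
    (GRing.isZmodMorphism.Build _ _ _ (@iter_additive _ r (word_act i j \o word_act j i))).
pose g z := plin (fun r => T r z) (cox_poly n).
have gB : zmod_morphism g.
  by move=> x y; rewrite /g /plin -sumrB; apply: eq_bigr => l _; rewrite raddfB mulrzBl.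
pose G : {additive wmod -> wmod} := HB.pack g (GRing.isZmodMorphism.Build _ _ g gB).
pose Z : {additive wmod -> wmod} := \0.
rewrite -[LHS]/(G z) -[RHS]/(Z z); apply: malg_span => w wz; rewrite /G /g /Z /=.
have [e n' w' red fr gw'] := lsplitP eij (fz _ wz).
rewrite (eq_plin (h := fun r => put i j e w' (edge_rem m i j ('X^n' * 'X^r)))).
  rewrite -(raddf_plin (put i j e w' \o (edge_rem m i j \o ('X^n' \*o idfun))) (fun r => 'X^r)).
  rewrite poly_plin /=.
  by rewrite rem_coxM // raddf0.
by move=> l _; rewrite -putXn iter_loop_put // mulrC.
Qed.

End Syllables.

(** * Modules over the edge rings *)

Section Representation.
Variables (I : choiceType) (m : coxeterMatrix I).
(** [S i] models the part of [V] at the vertex [i]; edges map between these parts, and the relators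
    vanish on them. *)
Variables (V : zmodType) (Y : I -> I -> {additive V -> V}) (S : I -> V -> Prop).
Hypotheses (S0 : forall i, S i 0) (SB : forall i u v, S i u -> S i v -> S i (u - v)).
Hypothesis SY : forall i j v, edge m i j -> S j v -> S i (Y i j v).
Hypothesis S_rel : forall i j n v, m i j = Some n -> edge m i j -> S i v ->
  plin (fun r => iter r (edge_loop Y i j) v) (cox_poly n) = 0.
Implicit Types (i j k : I) (w p : word I) (z x : {malg int[word I]}) (u v : V).

Lemma S_mulrz i v r : S i v -> S i (v *~ r).
Proof.
move=> Sv; have SN u : S i u -> S i (- u) by move=> Su; rewrite -sub0r; apply: SB.
have Sn r' : S i (v *+ r').
  by elim: r' => [|r' IH]; rewrite ?mulr0n // mulrSr -[X in _ + X]opprK; apply: SB => //; apply: SN.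
by case: r => r; rewrite ?NegzE ?mulrNz; [|apply: SN]; apply: Sn.
Qed.

Lemma S_lin (K : choiceType) (f : K -> V) i (x : {malg int[K]}) :
  (forall t, t \in msupp x -> S i (f t)) -> S i (lin f x).
Proof.
move=> Sf; rewrite /lin big_seq; elim/big_ind: _ => // [u v Su Sv|t tx].
  by rewrite -[X in _ + X]opprK; apply: SB => //; rewrite -sub0r; apply: SB.
exact/S_mulrz/Sf.
Qed.

Lemma S_letter_op l v : letter_ok m l -> S (end_vertex l) v -> S (fst_vertex l) (letter_op Y l v).
Proof.
case: l => [[[a b] e] n]; rewrite /letter_ok /end_vertex /fst_vertex /snd_vertex /=.
case/and3P=> eab _ _ Sv; have eba : edge m b a by rewrite edge_sym.
elim: n => [|n IH] /=; last by apply/SY/SY.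
by case: e Sv => // Sv; apply: SY.
Qed.

Lemma S_word_op k i w v : good m k i w -> S k v -> S i (word_op Y w v).
Proof.
elim: w i => [|l w IH] i /=; first by move/eqP->.
by case/and4P=> /eqP<- ok _ gw Sv; apply: S_letter_op => //; apply: IH.
Qed.

Lemma S_star k i x v : fits m k i x -> S k v -> S i (star Y x v).
Proof. by move=> fx Sv; apply: S_lin => w /fx gw; apply: S_word_op gw Sv. Qed.

Lemma plin_iterMX (T : {additive V -> V}) v (f : {poly int}) :
  plin (fun r => iter r T v) (f * 'X) = T (plin (fun r => iter r T v) f).
Proof.
pose g : {additive {poly int} -> V} := plin (fun r => iter r T v) \o ('X \*o idfun).
pose h : {additive {poly int} -> V} := T \o plin (fun r => iter r T v).
rewrite mulrC -[LHS]/(g f) -[RHS]/(h f); apply: poly_span => n _; rewrite /g /h /=.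
by rewrite -exprS !plinXn.
Qed.

(** A polynomial and its remainder differ by a multiple of [cox_poly n], which acts as zero by
    [S_rel]. *)
Lemma plin_rem i j v (f : {poly int}) : edge m i j -> S i v ->
  plin (fun r => iter r (edge_loop Y i j) v) (edge_rem m i j f) =
  plin (fun r => iter r (edge_loop Y i j) v) f.
Proof.
move=> eij Sv; case mij: (m i j) => [n|]; last first.
  by rewrite /edge_rem /edge_poly mij Pdiv.Ring.rmodp0.
have mon := cox_poly_monic (label_gt0 mij).
rewrite {2}(Pdiv.RingMonic.rdivp_eq mon f) /edge_rem /edge_poly mij raddfD /=.
set q := Pdiv.Ring.rdivp _ _; rewrite (_ : plin _ (q * _) = 0) ?add0r //.
pose T : {additive V -> V} := Y i j \o Y j i.
rewrite -[edge_loop Y i j]/(T : V -> V).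
elim/poly_ind: q => [|q c IH]; first by rewrite mul0r raddf0.
rewrite mulrDl raddfD /= mulrAC plin_iterMX IH raddf0 add0r.
rewrite mul_polyC -[c]intz scaler_int raddfMz /=.
by rewrite (S_rel mij eij Sv) mul0rz.
Qed.

Lemma word_op_wcons i j e n w v : word_op Y (wcons i j e n w) v =
  iter n (edge_loop Y i j) (if e then Y i j (word_op Y w v) else word_op Y w v).
Proof. by rewrite /wcons; case: e => //=; case: posnP => // ->. Qed.

Lemma star_put i j e w (f : {poly int}) v :
  star Y (put i j e w f) v = plin (fun r => word_op Y (wcons i j e r w) v) f.
Proof.
rewrite /star /put raddf_plin; apply: eq_plin => r _ /=.
by rewrite linU.
Qed.

(** Rewriting a product into reduced words does not change its value in [V]: the only reduction is
    the one covered by [plin_rem]. *)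
Lemma star_word_actU k i j w v : edge m i j -> good m k j w -> S k v ->
  star Y (word_act m i j << w >>) v = Y i j (word_op Y w v).
Proof.
move=> eij gw Sv; have eji : edge m j i by rewrite edge_sym.
have [e n w' red fr gw'] := lsplitP eji gw.
have Su := S_word_op gw' Sv.
have red' : edge_rem m i j 'X^n = 'X^n by rewrite rem_sym.
rewrite word_act_wcons // 1?lfree_sym // star_put.
rewrite (eq_plin (h := fun r => iter r (edge_loop Y i j)
  (if ~~ e then Y i j (word_op Y w' v) else word_op Y w' v))); last first.
  by move=> r _; rewrite word_op_wcons.
rewrite word_op_wcons -exprD; case: e gw' Su => /= _ Su.
  rewrite plin_rem // plinXn add1n /= -iter_edge_loop.
  by rewrite -/(edge_loop Y i j _) -iterSr.
by rewrite add0n red' plinXn iter_edge_loop.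
Qed.

Lemma star_word_act k i j z v : edge m i j -> fits m k j z -> S k v ->
  star Y (word_act m i j z) v = Y i j (star Y z v).
Proof.
move=> eij fz Sv.
pose g : {additive {malg int[word I]} -> V} := star_at Y v \o word_act m i j.
pose h : {additive {malg int[word I]} -> V} := Y i j \o star_at Y v.
rewrite -[LHS]/(g z) -[RHS]/(h z); apply: malg_span => w /fz gw.
by rewrite /g /h /= /star_at (star_word_actU eij gw Sv) starU.
Qed.

End Representation.

Section WordModule.
Variables (I : choiceType) (m : coxeterMatrix I).
Implicit Types (i j k : I) (w p : word I) (z x : {malg int[word I]}).
Local Notation act := (word_act m).

Lemma fits0 k i : fits m k i 0.
Proof. by move=> w; rewrite msupp0 inE. Qed.

Lemma fitsB k i x z : fits m k i x -> fits m k i z -> fits m k i (x - z).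
Proof.
move=> fx fz w /(fsubsetP (msuppB_le _ _)); rewrite inE.
by case/orP=> [/fx|/fz].
Qed.

Definition fits_word_op k i j w z : good m j i w -> fits m k j z -> fits m k i (word_op act w z) :=
  S_word_op (fun i j v => @fits_word_act I m k i j v) (w := w) (v := z).

Lemma fits_path k i s z : path (edge m) i s -> fits m k (last i s) z ->
  fits m k i (path_op act i s z).
Proof.
elim: s i => [|j s IH] i //= /andP[eij pjs] fz.
by apply: fits_word_act => //; apply: IH.
Qed.

Lemma fits_star k i j x z : fits m j i x -> fits m k j z -> fits m k i (star act x z).
Proof.
apply: (@S_star I m _ act (fits m k)) => //; [exact: fits0|exact: fitsB|].
by move=> *; apply: fits_word_act.
Qed.

End WordModule.

(** * Associativity of the action of words *)

Section StarAssoc.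
Variables (I : choiceType) (m : coxeterMatrix I).
Variables (V : zmodType) (Y : I -> I -> {additive V -> V}) (S : I -> V -> Prop).
Hypotheses (S0 : forall i, S i 0) (SB : forall i u v, S i u -> S i v -> S i (u - v)).
Hypothesis SY : forall i j v, edge m i j -> S j v -> S i (Y i j v).
Hypothesis S_rel : forall i j n v, m i j = Some n -> edge m i j -> S i v ->
  plin (fun r => iter r (edge_loop Y i j) v) (cox_poly n) = 0.
Implicit Types (i j k : I) (w p : word I) (z x : {malg int[word I]}) (u v : V).
Local Notation act := (word_act m).
Let SA := star_word_act SY S_rel.

Lemma star_letter_op k l z v : letter_ok m l -> fits m k (end_vertex l) z -> S k v ->
  star Y (letter_op act l z) v = letter_op Y l (star Y z v).
Proof.
case: l => [[[a b] e] n]; rewrite /letter_ok /end_vertex /fst_vertex /snd_vertex /=.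
case/and3P=> eab _ _ fz Sv; have eba : edge m b a by rewrite edge_sym.
set z0 := (if e then act a b z else z).
have f0 : fits m k a z0 by rewrite /z0; case: (e) fz => // fz; apply: fits_word_act.
have -> : (if e then Y a b (star Y z v) else star Y z v) = star Y z0 v.
  by rewrite /z0; case: (e) fz => // fz; rewrite (SA eab fz Sv).
elim: n => // n IH /=; rewrite -IH.
have fn : fits m k a (iter n (fun z1 => act a b (act b a z1)) z0).
  by elim: n {IH} => // n fn /=; apply/fits_word_act => //; apply/fits_word_act.
by rewrite (SA eab (fits_word_act eba fn) Sv) (SA eba fn Sv).
Qed.

Lemma star_word_op k j i w z v : good m j i w -> fits m k j z -> S k v ->
  star Y (word_op act w z) v = word_op Y w (star Y z v).
Proof.
move=> gw fz Sv; elim: w i gw => //= l w IH i /and4P[_ ok _ gw].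
by rewrite (star_letter_op ok (fits_word_op gw fz) Sv) (IH _ gw).
Qed.

(** With [V] the word module itself this becomes associativity of the product of words. *)
Lemma star_star k j i x z v : fits m j i x -> fits m k j z -> S k v ->
  star Y (star act x z) v = star Y x (star Y z v).
Proof.
move=> fx fz Sv; pose g : {additive {malg int[word I]} -> V} := star_at Y v \o star_at act z.
pose h : {additive {malg int[word I]} -> V} := star_at Y (star Y z v).
rewrite -[LHS]/(g x) -[RHS]/(h x); apply: malg_span => w /fx gw.
by rewrite /g /h /= /star_at !starU (star_word_op gw fz Sv).
Qed.

Lemma star_path i s v : path (edge m) i s -> S (last i s) v ->
  star Y (path_op act i s << [::] >>) v = path_op Y i s v.
Proof.
elim: s i => [|j s IH] i /=; first by rewrite starU.
move=> /andP[eij pjs] Sv; rewrite -(IH j pjs Sv); apply: SA eij _ Sv.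
by apply: fits_path => //; apply: fitsU => /=.
Qed.

End StarAssoc.

(** * Products of words *)

Section Products.
Variables (I : choiceType) (m : coxeterMatrix I).
Implicit Types (i j k a b c d : I) (l : letter I) (p q r s t w : word I)
  (x y z : {malg int[word I]}).
Local Notation act := (word_act m).

Lemma wcons_pos i j e n w : e || (0 < n)%N -> wcons i j e n w = (i, j, e, n) :: w.
Proof. by rewrite /wcons => ->. Qed.

Lemma wcons0 i j w : wcons i j false 0 w = w.
Proof. by []. Qed.

Lemma word_op_put a b e n c d e' (f : {poly int}) w :
  c = (if e then b else a) -> d = (if e then a else b) ->
  edge m a b -> lfree a b w -> edge_rem m a b f = f ->
  word_op act (wcons a b e n [::]) (put c d e' w f) =
  put a b (e (+) e') w (edge_rem m a b ('X^(n + (e && e')) * f)).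
Proof.
move=> ec ed eab fr red; rewrite -(letter_op_put n e' ec ed eab fr red).
by rewrite /wcons; case: ifP => //; case: e ec ed => //=; case: posnP => // ->.
Qed.

Lemma letter_op_free l w : letter_ok m l -> lfree (fst_vertex l) (snd_vertex l) w ->
  letter_op act l << w >> = << l :: w >>.
Proof.
case: l => [[[a b] e] n]; rewrite /letter_ok /fst_vertex /snd_vertex /=.
case/and3P=> eab pos /eqP red fr.
rewrite -[<< w >>](put1 (if e then b else a) (if e then a else b)).
rewrite -/(letter_op act (a, b, e, n) _) letter_op_put ?rem1 //.
by rewrite andbF addn0 mulr1 addbF red putXn wcons_pos.
Qed.

Lemma word_op_concat k i p q : good m k i (p ++ q) ->
  word_op act p << q >> = << p ++ q >>.
Proof.
elim: p i => //= l p IH i /and4P[_ ok fr gpq].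
by rewrite (IH _ gpq) letter_op_free.
Qed.

Lemma msupp_malgU w r : (r \in msupp (<< w >> : {malg int[word I]})) = (r == w).
Proof. by rewrite msuppU oner_eq0 inE. Qed.

Lemma put_msupp i j e w (f : {poly int}) r : r \in msupp (put i j e w f) ->
  exists2 n, f`_n != 0 & r = wcons i j e n w.
Proof. by case/plin_msupp=> n fn; rewrite msupp_malgU => /eqP; exists n. Qed.

(** If [w] begins along the edge of [l] the two letters merge, possibly into nothing, and the length
    does not grow. *)
Lemma letter_op_msupp k l w r : letter_ok m l -> good m k (end_vertex l) w ->
  r \in msupp (letter_op act l << w >>) -> (size r <= size w)%N \/ r = l :: w.
Proof.
case: l => [[[a b] e] n] ok; have := ok; rewrite /letter_ok /end_vertex /fst_vertex /snd_vertex.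
move=> /= /and3P[eab _ _] gw.
set c := (if e then b else a); set d := (if e then a else b).
have ecd : edge m c d by rewrite /c /d; case: (e); rewrite // edge_sym.
have rcd f : edge_rem m c d f = edge_rem m a b f.
  by rewrite /c /d; case: (e) => //; rewrite rem_sym.
have [e' n' w' red fr gw'] := lsplitP ecd gw.
have fr' : lfree a b w' by move: fr; rewrite /c /d; case: (e); rewrite // lfree_sym.
case pos: (e' || (0 < n')%N); last first.
  rewrite /wcons pos -/(letter_op act (a, b, e, n) _) letter_op_free // msupp_malgU.
  by move/eqP; right.
rewrite -putXn -/(letter_op act (a, b, e, n) _) letter_op_put //; last by rewrite -rcd.
case/put_msupp=> n'' _ ->; left.
by have /andP[_] := size_wcons a b (e (+) e') n'' w'; rewrite [wcons c _ _ _ _]wcons_pos.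
Qed.

(** Any merging loses a letter, so the plain concatenation is the only term of full length. *)
Lemma word_op_msupp k j i p q r : good m j i p -> good m k j q ->
  r \in msupp (word_op act p << q >>) -> (size r < size p + size q)%N \/ r = p ++ q.
Proof.
move=> gp gq; elim: p i gp r => [|l p IH] i gp r /=.
  by rewrite msupp_malgU => /eqP; right.
move: gp => /= /and4P[_ ok _ gp].
rewrite -[word_op act p _]malg_lin (raddf_lin (letter_op act l)) => /lin_msupp[w wz /= rw].
have gw : good m k (end_vertex l) w.
  by apply: (@fits_word_op _ _ k (end_vertex l) j p << q >> gp _ w wz); apply: fitsU.
case: (IH _ gp w wz) (letter_op_msupp ok gw rw) => [lt|->] [le|->] /=; last by right.
- by left; lia.
- by left; lia.
- by left; rewrite size_cat in le; lia.
Qed.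

Lemma star_at1 j i x : fits m j i x -> star act x << [::] >> = x.
Proof.
move=> fx; rewrite -[RHS]malg_lin; apply: eq_lin => w /fx gw.
by rewrite (@word_op_concat j i) cats0.
Qed.

Lemma star1 x : star act << [::] >> x = x.
Proof. exact: starU. Qed.

Lemma malg_mulrz_eq0 (K : choiceType) (x : {malg int[K]}) (c : int) :
  c != 0 -> x *~ c = 0 -> x = 0.
Proof.
move=> c0 xc; apply/malgP => t; rewrite mcoeff0; apply/eqP.
have /eqP := congr1 (mcoeff t) xc.
by rewrite raddfMz mcoeff0 mulrz_eq0 (negPf c0).
Qed.

Lemma rem_reduced i j (f : {poly int}) :
  (forall n, f`_n != 0 -> edge_rem m i j 'X^n = 'X^n) -> edge_rem m i j f = f.
Proof.
move=> red; exact: (poly_span (g := edge_rem m i j) (h := idfun)).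
Qed.

Lemma reduced_coef i j (f : {poly int}) n :
  edge_rem m i j f = f -> f`_n != 0 -> edge_rem m i j 'X^n = 'X^n.
Proof. by move=> red fn; apply: (remXn_coef (f := f)); rewrite red. Qed.

End Products.

Section Slice.
Variables (K : choiceType) (g : nat -> K) (idx : K -> nat).
Implicit Types x : {malg int[K]}.

(** The generating polynomial of the coefficients of [x] along [g], where [idx] is
    a left inverse of [g]. *)
Definition slice x : {poly int} :=
  lin (fun t => if t == g (idx t) then 'X^(idx t) else 0) x.
HB.instance Definition _ :=
  GRing.isZmodMorphism.Build {malg int[K]} {poly int} slice (lin_is_additive _).

Lemma sliceE x n : cancel g idx -> (slice x)`_n = x@_(g n).
Proof.
move=> gK; rewrite -[x in RHS]malg_lin lin_mcoeff.
rewrite -[LHS]/(coefp n (slice x)) /slice raddf_lin; apply: eq_lin => t _ /=.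
rewrite mcoeffU; case: eqP => tg.
  by rewrite coefXn [in RHS]tg (inj_eq (can_inj gK)) eq_sym.
by rewrite coef0; case: eqP => // tgn; case: tg; rewrite tgn gK.
Qed.

Lemma sliceU t : slice << t >> = if t == g (idx t) then 'X^(idx t) else 0.
Proof. exact: linU. Qed.

End Slice.

(** * Coefficients of products *)

Section Coefficient.
Variables (I : choiceType) (m : coxeterMatrix I).
Implicit Types (i j k a b c d : I) (p q w : word I) (x y z : {malg int[word I]}).
Local Notation act := (word_act m).

(** A power of [T] along [{j, b}] that ends at [j] with parity [e] starts at [rcase e j b]; the
    other vertex is [rcase e b j]. *)
Definition rcase (e : bool) j b : I := if e then b else j.
Definition rletter j b e n : word I := wcons (rcase e j b) (rcase e b j) e n [::].

Lemma on_edge_rcase e f n j b : on_edge j b (rcase e j b, rcase e b j, f, n).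
Proof. by rewrite /on_edge /fst_vertex /snd_vertex /rcase; case: e; rewrite !eqxx ?orbT. Qed.

Lemma rcase_inj e f j b : j != b -> rcase e j b = rcase f j b -> e = f.
Proof. by move=> jb; case: e f => [] [] //= E; rewrite -E eqxx in jb. Qed.

Lemma rfree_rcase g j b w : rfree (rcase g j b) (rcase g b j) w = rfree j b w.
Proof. by case: g => //=; rewrite /rfree lfree_sym. Qed.

Lemma lfree_rcase g j b w : lfree (rcase g j b) (rcase g b j) w = lfree j b w.
Proof. by case: g => //=; rewrite lfree_sym. Qed.

Lemma edge_rcase g j b : edge m (rcase g j b) (rcase g b j) = edge m j b.
Proof. by case: g => //=; rewrite edge_sym. Qed.

Lemma rem_rcase g j b : edge_rem m (rcase g j b) (rcase g b j) =1 edge_rem m j b.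
Proof. by case: g => //= h; rewrite rem_sym. Qed.

Lemma rsplit_inj j b p p' e e' n n' : rfree j b p -> rfree j b p' ->
  p ++ rletter j b e n = p' ++ rletter j b e' n' -> [/\ p = p', e = e' & n = n'].
Proof.
move=> fr fr'; rewrite /rletter /wcons; case: ifP => pos; case: ifP => pos'.
- by rewrite !cats1 => /rcons_inj[-> _ _ -> ->].
- rewrite cats0 cats1 => E; move: fr'; rewrite -E rfree_rcons.
  by rewrite on_edge_rcase.
- rewrite cats0 cats1 => E; move: fr; rewrite E rfree_rcons.
  by rewrite on_edge_rcase.
- rewrite !cats0 => ->; case: e e' pos pos' => [] [] //=.
  by case: n n' => [|n] [].
Qed.

Lemma lsplit_inj j b q q' e e' n n' : lfree j b q -> lfree j b q' ->
  wcons j b e n q = wcons j b e' n' q' -> [/\ q = q', e = e' & n = n'].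
Proof.
have on f (r : nat) : on_edge j b (j, b, f, r) by exact: (on_edge_rcase false).
move=> fr fr'; rewrite /wcons; case: ifP => pos; case: ifP => pos'.
- by case=> -> -> ->.
- by move=> E; move: fr'; rewrite -E /= on.
- by move=> E; move: fr; rewrite E /= on.
- by move=> ->; case: e e' pos pos' => [] [] //=; case: n n' => [|n] [].
Qed.

(** Length after deletion of the last letter, if that letter is along [{j, b}]. *)
Definition trim_size j b p : nat := if rfree j b p then size p else (size p).-1.

Lemma trim_size_rletter j b p e n : rfree j b p -> trim_size j b (p ++ rletter j b e n) = size p.
Proof.
move=> fr; rewrite /rletter /wcons; case: ifP => _; first last.
  by rewrite cats0 /trim_size fr.
by rewrite cats1 /trim_size rfree_rcons on_edge_rcase size_rcons.
Qed.

Lemma word_op_merge j b p q e f n n' : edge m j b -> edge_rem m j b 'X^n' = 'X^n' -> lfree j b q ->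
  word_op act (p ++ rletter j b e n) << wcons j b f n' q >> =
  word_op act p (put (rcase e j b) (rcase e b j) (e (+) f) q
    (edge_rem m j b ('X^(e && f) * 'X^n * 'X^n'))).
Proof.
move=> ejb red fr; rewrite word_op_cat -putXn; congr (word_op _ _ _).
have ea : edge m (rcase e j b) (rcase e b j) by rewrite /rcase; case: (e); rewrite // edge_sym.
have re h : edge_rem m (rcase e j b) (rcase e b j) h = edge_rem m j b h.
  by rewrite /rcase; case: (e); rewrite // rem_sym.
rewrite /rletter word_op_put //; try by rewrite /rcase; case: (e).
- by rewrite re [(n + _)%N]addnC exprD.
- by rewrite /rcase; case: (e); rewrite // lfree_sym.
- by rewrite re.
Qed.

Section Fixed.
Variables (i j k b : I) (N M : nat) (e f : bool) (p q : word I).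
Hypotheses (ejb : edge m j b) (frp : rfree j b p) (frq : lfree j b q).
Hypotheses (sp : size p = N) (sq : size q = M).

(** The value [0] at the empty word is the exponent of the absent letter [T ^ 0]. *)
Let head_expo w := if w is (_, _, _, n) :: _ then n else 0%N.
(** [rslice x] collects the words of [x] that extend [p] by a power of parity [e], and [lslice y]
    those of [y] that extend [q] by one of parity [f]. They become the factors [v] and [u] of the
    main argument. *)
Definition rslice : {malg int[word I]} -> {poly int} :=
  slice (fun n => p ++ rletter j b e n) (fun w => head_expo (drop (size p) w)).
Definition lslice : {malg int[word I]} -> {poly int} := slice (fun n => wcons j b f n q)
  (fun w => head_expo (take (size w - size q) w)).

Let rK : cancel (fun n => p ++ rletter j b e n) (fun w => head_expo (drop (size p) w)).
Proof.
move=> n; rewrite drop_size_cat // /rletter /wcons.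
by case: e => //=; case: posnP => // ->.
Qed.

Let lK : cancel (fun n => wcons j b f n q) (fun w => head_expo (take (size w - size q) w)).
Proof.
move=> n; rewrite /wcons; case: ifP => [_|] /=; first by rewrite subSn // subnn take0.
by rewrite subnn take0; case: f => //=; case: posnP.
Qed.

HB.instance Definition _ :=
  GRing.isZmodMorphism.Build {malg int[word I]} {poly int} rslice (lin_is_additive _).
HB.instance Definition _ :=
  GRing.isZmodMorphism.Build {malg int[word I]} {poly int} lslice (lin_is_additive _).

Lemma rsliceE x n : (rslice x)`_n = x@_(p ++ rletter j b e n).
Proof. exact: sliceE. Qed.

Lemma lsliceE x n : (lslice x)`_n = x@_(wcons j b f n q).
Proof. exact: sliceE. Qed.

Lemma rsliceU p1 e1 n : rfree j b p1 ->
  rslice << p1 ++ rletter j b e1 n >> = if (p1 == p) && (e1 == e) then 'X^n else 0.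
Proof.
move=> fr; rewrite /rslice sliceU; case: eqP => [/(rsplit_inj fr frp)[-> -> <-]|ne].
  by rewrite !eqxx.
case: andP => // -[/eqP ep /eqP ee]; case: ne; rewrite ep ee.
by rewrite (rK n).
Qed.

Lemma lsliceU q1 f1 n : lfree j b q1 ->
  lslice << wcons j b f1 n q1 >> = if (q1 == q) && (f1 == f) then 'X^n else 0.
Proof.
move=> fr; rewrite /lslice sliceU; case: eqP => [/(lsplit_inj fr frq)[-> -> <-]|ne].
  by rewrite !eqxx.
case: andP => // -[/eqP ep /eqP ee]; case: ne; rewrite ep ee.
by rewrite (lK n).
Qed.

Section Target.
(** [pos] makes the middle letter of [r] genuine, so [r] has exactly [N + M + 1] letters. *)
Variables (l : nat) (pos : (e (+) f) || (0 < l)%N).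
Let r := p ++ (rcase e j b, rcase e b j, e (+) f, l) :: q.

(** The length bounds leave room for a single decomposition of [r]. The bound on [q1] is [M.+1]
    because [q1] may be a whole word of the right factor, one that does not start along the edge. *)
Lemma coef_concat p1 q1 e1 g1 l1 : rfree j b p1 -> lfree j b q1 ->
  good m (rcase e1 j b) i p1 ->
  good m k (rcase g1 (rcase e1 j b) (rcase e1 b j)) q1 ->
  edge_rem m j b 'X^l1 = 'X^l1 -> (size p1 <= N)%N -> (size q1 <= M.+1)%N ->
  (word_op act p1 << wcons (rcase e1 j b) (rcase e1 b j) g1 l1 q1 >>)@_r =
  ([&& p1 == p, q1 == q, e1 == e, g1 == e (+) f & l1 == l])%:R.
Proof.
move=> fr1 frq1 gp1 gq1 red sp1 sq1.
set a1 := rcase e1 j b; set o1 := rcase e1 b j.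
have e1a : edge m a1 o1 by rewrite edge_rcase.
case pos1: (g1 || (0 < l1)%N).
  rewrite wcons_pos // (@word_op_concat _ _ k i); last first.
    rewrite good_cat /= /letter_ok /= gp1 rfree_rcase fr1 /fst_vertex /snd_vertex /= eqxx e1a pos1.
    by rewrite rem_rcase red eqxx lfree_rcase frq1.
  rewrite mcoeffU; congr (_%:R); congr (nat_of_bool _); apply/eqP/and5P; last first.
    by case=> /eqP-> /eqP-> /eqP ee /eqP-> /eqP->; rewrite /r /a1 /o1 ee.
  move=> E; have sE : (size p1 + size q1)%N = (N + M)%N.
    by move/(congr1 size): E; rewrite /r !size_cat /= sp sq !addnS => -[].
  move: E; rewrite /r; have [sp1N|sp1N] := eqVneq (size p1) (size p).
    move/eqP; rewrite eqseq_cat // => /andP[/eqP-> /eqP[ea _ -> -> ->]].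
    by rewrite !eqxx; split => //; rewrite (rcase_inj (edge_neq ejb) ea).
  (* Now [q1] has length [M + 1], and the middle letter would be the last one of [p], against
     [frp]. *)
  have sp1S : (size p1).+1 = size p.
    apply/eqP; rewrite eqn_leq ltn_neqAle sp1N sp sp1 /=.
    by rewrite -(leq_add2r M) -sE addSnnS leq_add2l.
  rewrite -cat_rcons => /eqP; rewrite eqseq_cat ?size_rcons //.
  by case/andP=> /eqP E _; move: frp; rewrite -E rfree_rcons on_edge_rcase.
(* The middle power is trivial here: full length forces a plain concatenation, and then [q1] would
   start along the edge. *)
have [g10 l10] : g1 = false /\ l1 = 0%N by case: (g1) pos1 => //; case: (l1).
rewrite g10 l10 wcons0 in gq1 *.
rewrite [RHS](_ : _ = 0); last first.
  rewrite (_ : (false == e (+) f) && (0%N == l) = false) ?andbF //; apply/negbTE.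
  by move: pos; rewrite lt0n; case: (e (+) f) => //=; rewrite eq_sym.
apply/eqP; rewrite mcoeff_eq0; apply/negP => /(word_op_msupp gp1 gq1).
rewrite /r size_cat /= sp sq; case; first by rewrite ltnNge leq_add.
move=> /eqP E; move: (E) => /eqP /(congr1 size); rewrite !size_cat /= sp sq => sE.
have sp1N : size p = size p1.
  apply/eqP; rewrite eqn_leq sp sp1 andbT -(leq_add2r M.+1) sE.
  by rewrite leq_add2l.
move: E; rewrite eqseq_cat //.
by case/andP=> _ /eqP E; move: frq1; rewrite -E /= on_edge_rcase.
Qed.

Lemma coef_word_op p1 q1 : good m j i p1 -> good m k j q1 ->
  (trim_size j b p1 <= N)%N -> (size q1 <= M.+1)%N ->
  (word_op act p1 << q1 >>)@_r =
  (edge_rem m j b ('X^(e && f) * rslice << p1 >> * lslice << q1 >>))`_l.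
Proof.
move=> gp1 gq1.
have [e1 n1 {}p1 red1 fr1 {}gp1] := rsplitP ejb gp1.
have [f1 n2 {}q1 red2 frq1 {}gq1] := lsplitP ejb gq1.
rewrite -/(rcase e1 j b) -/(rcase e1 b j) -/(rletter j b e1 n1).
rewrite trim_size_rletter // => sp1 sq1.
have {}sq1 : (size q1 <= M.+1)%N.
  by apply: leq_trans sq1; have /andP[] := size_wcons j b f1 n2 q1.
rewrite word_op_merge // rsliceU // lsliceU //.
set h := edge_rem m j b _; have hred : edge_rem m j b h = h by rewrite rem_id.
rewrite /put (raddf_plin (word_op act p1)) (raddf_plin (mcoeff r)) /=.
rewrite (eq_plin (h := fun l1 =>
  [&& p1 == p, q1 == q, e1 == e, e1 (+) f1 == e (+) f & l1 == l]%:R)).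
  case: (p1 =P p) => [ep|_] /=; last by rewrite mulr0 mul0r (raddf0 (edge_rem m j b)) coef0 plin_f0.
  case: (e1 =P e) => [ee|_] /=; last first.
    rewrite mulr0 mul0r (raddf0 (edge_rem m j b)) coef0 -[RHS](plin_f0 _ h).
    by apply: eq_plin => l1 _; rewrite andbF.
  rewrite ee (inj_eq (@addbI e)).
  case: (q1 =P q) => [eq|_] /=; last by rewrite mulr0 (raddf0 (edge_rem m j b)) coef0 plin_f0.
  case: (f1 =P f) => [ef|_] /=; last by rewrite mulr0 (raddf0 (edge_rem m j b)) coef0 plin_f0.
  by rewrite plin_delta /h ee ef.
move=> l1 hl1; apply: coef_concat => //; last exact: reduced_coef hred hl1.
by move: gq1; rewrite /rcase; case: (e1); case: (f1).
Qed.

(** By bilinearity from single words: at [r] only the two slices contribute. The factor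
    ['X^(e && f)] is the carry of two odd parities. *)
Lemma coef_star x y : fits m j i x -> fits m k j y ->
  (forall p1, p1 \in msupp x -> (trim_size j b p1 <= N)%N) ->
  (forall q1, q1 \in msupp y -> (size q1 <= M.+1)%N) ->
  (star act x y)@_r = (edge_rem m j b ('X^(e && f) * rslice x * lslice y))`_l.
Proof.
move=> fx fy sx sy.
pose C : {additive {poly int} -> int} := coefp l \o edge_rem m j b.
pose g1 : {additive {malg int[word I]} -> int} := mcoeff r \o star_at act y.
pose h1 : {additive {malg int[word I]} -> int} :=
  C \o (('X^(e && f) * lslice y) \*o rslice).
rewrite mulrAC -[LHS]/(g1 x) -[RHS]/(h1 x).
apply: malg_span => p1 p1x; rewrite /g1 /h1 /= /star_at starU.
pose g2 : {additive {malg int[word I]} -> int} := mcoeff r \o word_op act p1.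
pose h2 : {additive {malg int[word I]} -> int} :=
  C \o (('X^(e && f) * rslice << p1 >>) \*o lslice).
rewrite mulrAC -[LHS]/(g2 y) -[RHS]/(h2 y); apply: malg_span => q1 q1y.
by rewrite /g2 /h2 /= coef_word_op //; [exact: fx|exact: fy|exact: sx|exact: sy].
Qed.

End Target.
End Fixed.
End Coefficient.

(** * Absence of zero divisors for words *)

Lemma malg_eq0 (K : choiceType) (x : {malg int[K]}) :
  (forall t, t \notin msupp x) -> x = 0.
Proof. by move=> x0; apply/malgP => t; rewrite mcoeff0 mcoeff_outdom. Qed.

Lemma max_msupp (K : choiceType) (x : {malg int[K]}) (h : K -> nat) : x != 0 ->
  exists2 t, t \in msupp x & forall u, u \in msupp x -> (h u <= h t)%N.
Proof.
move=> x0; have [t0 xt0] : exists t, t \in msupp x.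
  have [//|no] := pselect (exists t, t \in msupp x).
  by case/eqP: x0; apply: malg_eq0 => t; apply/negP => tx; apply: no; exists t.
have [t _ tmax] := arg_maxnP (P := predT) (fun t : msupp x => h (val t))
  (erefl : predT [` xt0]%fset).
by exists (val t) => [|u xu]; [exact: valP|exact: (tmax [` xu]%fset)].
Qed.

Section NoZeroDivisors.
Variables (I : choiceType) (m : coxeterMatrix I).
Implicit Types (i j k a b c d : I) (p q w : word I) (x y z : {malg int[word I]}).
Local Notation act := (word_act m).

Let SYF k := fun i j v => @fits_word_act I m k i j v.
Let SRF k := fun i j n v => @word_act_relation I m k i j n v.

Lemma star_assoc l k j i x y z : fits m j i x -> fits m k j y -> fits m l k z ->
  star act (star act x y) z = star act x (star act y z).
Proof. exact: (star_star (SYF (k := l)) (SRF (k := l))). Qed.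

Lemma star_const (c : int) z : star act (<< [::] >> *~ c) z = z *~ c.
Proof. by rewrite -[LHS]/(star_at act z _) raddfMz /= /star_at star1. Qed.

Lemma good_rletter j b i p e n : good m j i (p ++ rletter j b e n) -> edge_rem m j b 'X^n = 'X^n.
Proof.
rewrite /rletter /wcons; case: ifP => [_|]; last by case: e; case: n => //; rewrite rem1.
rewrite good_cat => /and3P[_ _ /= /and3P[_ /and3P[_ _ /eqP red] _]].
by rewrite -(rem_rcase m e j b).
Qed.

Lemma good_wcons_red k j b e n q : good m k j (wcons j b e n q) -> edge_rem m j b 'X^n = 'X^n.
Proof.
rewrite /wcons; case: ifP => [_|]; last by case: e; case: n => //; rewrite rem1.
by move=> /= /and4P[_ /and3P[_ _ /eqP red] _ _].
Qed.

Lemma put_mcoeff j b e w (f : {poly int}) n : lfree j b w ->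
  (put j b e w f)@_(wcons j b e n w) = f`_n.
Proof.
move=> fr; rewrite (raddf_plin (mcoeff _)) -[RHS]plin_delta; apply: eq_plin => l _ /=.
rewrite mcoeffU; congr (_%:R); congr (nat_of_bool _).
by apply/eqP/eqP => [/(lsplit_inj fr fr)[]|->].
Qed.

Lemma lslice_put j b e e' w (f : {poly int}) : lfree j b w -> e = e' ->
  lslice j b e w (put j b e' w f) = f.
Proof. by move=> fr <-; apply/polyP => n; rewrite lsliceE put_mcoeff. Qed.

Lemma poly_const (f : {poly int}) : (forall n, (0 < n)%N -> f`_n = 0) -> f = (f`_0)%:P.
Proof.
by move=> f0; apply/polyP => -[|n]; rewrite coefC //=; apply: f0.
Qed.

Lemma put_const j b w (c : int) : put j b false w c%:P = << w >> *~ c.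
Proof.
have -> : c%:P = 1 *~ c :> {poly int} by rewrite -[c in LHS]intz rmorph_int.
by rewrite raddfMz /= put1.
Qed.

Lemma star_put_put j b e (f g : {poly int}) w : edge m j b -> lfree j b w ->
  edge_rem m j b g = g ->
  star act (put j b e [::] f) (put (rcase e j b) (rcase e b j) e w g) =
  put j b false w (edge_rem m j b ('X^e * g * f)).
Proof.
move=> ejb fr red; rewrite star_put.
pose h1 : {additive {poly int} -> {malg int[word I]}} :=
  plin (fun r => word_op act (wcons j b e r [::])
   (put (rcase e j b) (rcase e b j) e w g)).
pose h2 : {additive {poly int} -> {malg int[word I]}} :=
  put j b false w \o (edge_rem m j b \o (('X^e * g) \*o idfun)).
rewrite -[LHS]/(h1 f) -[RHS]/(h2 f); apply: poly_span => n _; rewrite /h1 /h2 /= plinXn.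
rewrite word_op_put // addbb andbb; congr (put _ _ _ _ (edge_rem _ _ _ _)).
by rewrite exprD -mulrA mulrC.
Qed.

Theorem star_eq0 N k j i x y : fits m j i x -> fits m k j y ->
  (forall p, p \in msupp x -> (size p < N)%N) -> star act x y = 0 -> x = 0 \/ y = 0.
Proof.
elim: N k j i x y => [|N IH] k j i x y fx fy sx xy0.
  by left; apply: malg_eq0 => p; apply/negP => /sx.
have [->|x0] := eqVneq x 0; first by left.
have [->|y0] := eqVneq y 0; first by right.
exfalso.
have [[|[[[j' b] f] n2] q] qy qmax] := max_msupp size y0.
  (* If the longest word is empty, [y] is a nonzero integer multiple of it, and the free module on
     words has no torsion. *)
  have yc : y = << [::] >> *~ y@_[::].
    apply/malgP => w; rewrite raddfMz /= mcoeffU.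
    case: eqP => [<-|nw]; first by rewrite intz.
    rewrite mul0rz; apply/mcoeff_outdom/negP => /qmax; rewrite leqn0 => /nilP wn.
    by case: nw.
  move: xy0; rewrite yc raddfMz /=.
  have jk : k = j by apply/esym/eqP; exact: (fy _ qy).
  rewrite (star_at1 fx) => /malg_mulrz_eq0 xz; case/eqP: x0; apply: xz.
  by rewrite mcoeff_neq0.
have gq := fy _ qy; have := gq; rewrite /= /letter_ok /fst_vertex /snd_vertex /end_vertex /=.
move=> /and4P[/eqP ej /and3P[ejb pos2 _] frq gq']; subst j'.
have qE : (j, b, f, n2) :: q = wcons j b f n2 q by rewrite wcons_pos.
(* [trim_size] disregards last letters along the edge, so splitting [p0] yields a [p] of largest
   length. *)
have [p0 p0x p0max] := max_msupp (trim_size j b) x0.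
have := fx _ p0x => gp0.
case: (rsplitP ejb gp0) (p0x) (p0max) (gp0) => e n1 p _ frp gp.
rewrite -/(rcase e j b) -/(rcase e b j) -/(rletter j b e n1).
rewrite trim_size_rletter // => {}p0x {}p0max {}gp0.
set u := lslice j b f q y; set v := rslice j b e p x.
have v1 : v`_n1 != 0 by rewrite rsliceE mcoeff_neq0.
have u2 : u`_n2 != 0 by rewrite lsliceE -qE mcoeff_neq0.
have vred : edge_rem m j b v = v.
  apply: rem_reduced => n; rewrite rsliceE mcoeff_neq0 => /fx; exact: good_rletter.
have ured : edge_rem m j b u = u.
  apply: rem_reduced => n; rewrite lsliceE mcoeff_neq0 => /fy; exact: good_wcons_red.
(* The product of the two slices in the edge ring; its coefficients at genuine letters are
   coefficients of [star act x y]. *)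
pose g := edge_rem m j b ('X^(e && f) * v * u).
have qmax' w : w \in msupp y -> (size w <= (size q).+1)%N by move=> /qmax.
have g0 l : (e (+) f) || (0 < l)%N -> g`_l = 0.
  move=> pos; rewrite -(coef_star ejb frp frq erefl erefl pos fx fy p0max qmax').
  by rewrite xy0 mcoeff0.
have gN0 : g != 0.
  apply/eqP => /(rem_integral ejb); rewrite vred ured => -[] E.
    by rewrite E coef0 eqxx in v1.
  by rewrite E coef0 eqxx in u2.
(* With different parities every middle power is a genuine letter, so [g] would vanish. *)
have ef : e = f.
  apply/eqP; apply: contraNT gN0; rewrite -negb_add negbK => nef; apply/eqP/polyP => l.
  by rewrite g0 ?coef0 // nef.
subst f; set a0 := rcase e j b; set o0 := rcase e b j.
have gE : g = (g`_0)%:P by apply: poly_const => n n0; apply: g0; rewrite n0 orbT.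
have c0 : g`_0 != 0 by apply: contra_neq gN0 => c0; rewrite gE c0.
(* This strict bound drives the induction. If [p] had [N] letters, no word of [x] could properly
   extend it; then [v] is constant and [g] a nonzero multiple of [u], whose coefficient at [n2 > 0]
   contradicts [g0]. *)
have spN : (size p < N)%N.
  have szv n : v`_n != 0 -> (size (p ++ rletter j b e n) < N.+1)%N.
    by rewrite rsliceE mcoeff_neq0 => /sx.
  have spN : (size p <= N)%N.
    by rewrite -ltnS; apply: leq_ltn_trans (szv _ v1); rewrite size_cat leq_addr.
  rewrite ltn_neqAle spN andbT; apply/eqP => eN.
  have vN n : v`_n != 0 -> e = false /\ n = 0%N.
    move=> /szv; rewrite size_cat eN /rletter /wcons; case: ifP => /=; first by rewrite addn1 ltnn.
    by case: (e); case: (n).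
  have [eF _] := vN _ v1.
  have vE : v = (v`_0)%:P.
    apply: poly_const => n n0; apply/eqP; apply: contraT => /vN[_ n00].
    by rewrite n00 in n0.
  have gu : g = u *~ v`_0.
    rewrite /g eF expr0 mul1r {1}vE mul_polyC -[X in X *: _]intz scaler_int.
    by rewrite raddfMz /= ured.
  have n20 : (0 < n2)%N by move: pos2; rewrite eF.
  have v0 : v`_0 != 0 by apply: contra_neq v1 => v0; rewrite vE v0 coef0.
  have /eqP := g0 n2 (introT orP (or_intror n20)).
  rewrite gu -[_`_n2]/(coefp n2 _) raddfMz /= mulrz_eq0.
  by rewrite (negPf v0) (negPf u2).
(* [U] leads from [j] to [a0] and [W] back, both with parity [e]; the product [U * W] is given by
   [g], hence is an integer. *)
pose U := put j b e [::] u; pose W := put a0 o0 e [::] v.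
have e0 : edge m a0 o0 by rewrite edge_rcase.
have fU : fits m a0 j U by apply: fits_put => //; rewrite /= /a0 /rcase; case: (e).
have fW : fits m j a0 W.
  apply: fits_put => //; first by rewrite rem_rcase.
  by rewrite /= /a0 /o0 /rcase; case: (e).
have UW : star act U W = << [::] >> *~ g`_0.
  by rewrite -(put_const j b) -gE /g andbb star_put_put.
have UWy : star act U (star act W y) = y *~ g`_0.
  by rewrite -(star_assoc fU fW fy) UW star_const.
have xUW : star act (star act x U) W = x *~ g`_0.
  by rewrite (star_assoc fx fU fW) UW raddfMz /= (star_at1 fx).
have fxU := fits_star fx fU; have fWy := fits_star fW fy.
have sxU r : r \in msupp (star act x U) -> (size r < N)%N.
  move=> rxU; have [p1 p1x] := lin_msupp rxU.
  have := p0max _ p1x; have gp1 := fx _ p1x.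
  have [e1 n3 p2 _ frp2 gp2] := rsplitP ejb gp1.
  rewrite -/(rcase e1 j b) -/(rcase e1 b j) -/(rletter j b e1 n3).
  rewrite trim_size_rletter // => sp2.
  rewrite word_op_cat /rletter word_op_put //; first last.
  - by rewrite rem_rcase.
  - by rewrite edge_rcase.
  - by rewrite /rcase; case: (e1).
  - by rewrite /rcase; case: (e1).
  set h := edge_rem m _ _ _.
  rewrite /put (raddf_plin (word_op act p2)) => /plin_msupp[l hl] /=.
  have redl : edge_rem m j b 'X^l = 'X^l.
    by rewrite -(rem_rcase m e1); apply: reduced_coef hl; rewrite rem_id.
  set w := wcons _ _ _ _ _.
  have gw : good m a0 (rcase e1 j b) w.
    apply: good_wcons; rewrite ?edge_rcase ?rem_rcase //=.
    by rewrite /a0 /rcase; case: (e1); case: (e).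
  have [pos|npos] := boolP ((e1 (+) e) || (0 < l)%N); last first.
    rewrite /w /wcons (negPf npos) (@word_op_concat _ _ (rcase e1 j b) i) ?cats0 //.
    by rewrite msupp_malgU => /eqP->; apply: leq_ltn_trans spN.
  rewrite (@word_op_concat _ _ a0 i); last first.
    move: gw; rewrite /w wcons_pos // => gw.
    by rewrite good_cat /= gp2 rfree_rcase frp2.
  rewrite msupp_malgU => /eqP rE.
  (* If [p2] is shorter than [p], the new letter still fits below [N]; if it is as long, the
     coefficient has to vanish. *)
  have [eqp|nep] := eqVneq (size p2) (size p); last first.
    rewrite rE size_cat /w wcons_pos //= addn1.
    by apply: leq_ltn_trans spN; rewrite ltn_neqAle nep.
  move: rxU; rewrite -mcoeff_neq0 rE /w wcons_pos //.
  rewrite (coef_star (q := [::]) ejb frp2 _ eqp erefl pos fx fU) //; first last.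
  - by move=> q1 /put_msupp[n _ ->]; have /andP[] := size_wcons j b e n [::].
  (* The slice of [U] at the empty word is [u], the slice of [y] at [q]; so this coefficient of
     [x * U] equals one of [x * y]. *)
  rewrite lslice_put // -/(lslice j b e q y) -/u.
  rewrite -(coef_star ejb frp2 frq eqp erefl pos fx fy p0max qmax').
  by rewrite xy0 mcoeff0 eqxx.
(* The product of [x * U] and [W * y] is an integer multiple of [x * y]. If either factor is zero,
   then a nonzero multiple of [x] or of [y] is zero. *)
have := IH _ _ _ _ _ fxU fWy sxU; rewrite (star_assoc fx fU fWy) UWy raddfMz /= xy0 mul0rz.
case=> // E.
  move: xUW; rewrite E -[star act 0 W]/(star_at act W 0) raddf0 => /esym/(malg_mulrz_eq0 c0).
  exact/eqP.
move: UWy; rewrite E raddf0 => /esym/(malg_mulrz_eq0 c0).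
exact/eqP.
Qed.

End NoZeroDivisors.

(** * The action of the path algebra *)

Section PathAlgebraProduct.
Variables (I : choiceType) (m : coxeterMatrix I).
Implicit Types (i j k : I) (p q r : gpath m) (x y z : pathAlg m).

Lemma pmul_is_additive x : zmod_morphism (pmul x).
Proof. by move=> y z; rewrite pmulBr. Qed.
HB.instance Definition _ x :=
  GRing.isZmodMorphism.Build (pathAlg m) (pathAlg m) (pmul x) (pmul_is_additive x).

Definition pmulr y x := pmul x y.
Lemma pmulr_is_additive y : zmod_morphism (pmulr y).
Proof. by move=> x z; rewrite /pmulr pmulBl. Qed.
HB.instance Definition _ y :=
  GRing.isZmodMorphism.Build (pathAlg m) (pathAlg m) (pmulr y) (pmulr_is_additive y).

Lemma pmul0l y : pmul 0 y = 0.
Proof. exact: (raddf0 (pmulr y)). Qed.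

Lemma pmul0r x : pmul x 0 = 0.
Proof. exact: (raddf0 (pmul x)). Qed.

Lemma pmulUU p q : pmul << p >> << q >> = gpath_mul p q.
Proof.
by rewrite /pmul !msuppU oner_eq0 !big_seq_fset1 !mcoeffUU mulr1 scale1r.
Qed.

Lemma pmulU0 p q : terminus p != origin q -> pmul << p >> << q >> = 0.
Proof. by move=> /negPf pq; apply: etrans (pmulUU p q) _; rewrite /gpath_mul pq. Qed.

Lemma pmulU_cat p q : terminus p = origin q -> pmul << p >> << q >> = << gpath_cat p q >>.
Proof. by move=> pq; apply: etrans (pmulUU p q) _; rewrite /gpath_mul pq eqxx. Qed.

Lemma origin_cat p q : terminus p = origin q -> origin (gpath_cat p q) = origin p.
Proof. by move=> pq; rewrite /origin gpath_cat_val. Qed.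

Lemma terminus_cat p q : terminus p = origin q -> terminus (gpath_cat p q) = terminus q.
Proof.
move=> pq; rewrite {1}/terminus gpath_cat_val //= last_cat.
by rewrite -/(terminus p) pq.
Qed.

Lemma pmulUUU p q r :
  pmul << p >> (pmul << q >> << r >>) = pmul (pmul << p >> << q >>) << r >> :> pathAlg m.
Proof.
have [pq|pq] := eqVneq (terminus p) (origin q); have [qr|qr] := eqVneq (terminus q) (origin r).
- have pqr : terminus p = origin (gpath_cat q r) by rewrite origin_cat.
  have pqr' : terminus (gpath_cat p q) = origin r by rewrite terminus_cat.
  apply: etrans (congr1 (pmul _) (pmulU_cat qr)) _; apply: etrans (pmulU_cat pqr) _.
  apply: etrans (esym (etrans (congr1 (pmulr _) (pmulU_cat pq)) (pmulU_cat pqr'))).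
  congr << _ >>; apply: val_inj.
  by rewrite !gpath_cat_val //= catA.
- have pqr : terminus (gpath_cat p q) != origin r by rewrite terminus_cat.
  apply: etrans (etrans (congr1 (pmul _) (pmulU0 qr)) (pmul0r _)) _.
  exact: esym (etrans (congr1 (pmulr _) (pmulU_cat pq)) (pmulU0 pqr)).
- have pqr : terminus p != origin (gpath_cat q r) by rewrite origin_cat.
  apply: etrans (etrans (congr1 (pmul _) (pmulU_cat qr)) (pmulU0 pqr)) _.
  exact: esym (etrans (congr1 (pmulr _) (pmulU0 pq)) (pmul0l _)).
- apply: etrans (etrans (congr1 (pmul _) (pmulU0 qr)) (pmul0r _)) _.
  exact: esym (etrans (congr1 (pmulr _) (pmulU0 pq)) (pmul0l _)).
Qed.

Lemma pmulA x y z : pmul x (pmul y z) = pmul (pmul x y) z.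
Proof.
pose g1 : {additive pathAlg m -> pathAlg m} := pmulr (pmul y z).
pose h1 : {additive pathAlg m -> pathAlg m} := pmulr z \o pmulr y.
rewrite -[LHS]/(g1 x) -[RHS]/(h1 x); apply: malg_span => p _; rewrite /g1 /h1 /= /pmulr.
pose g2 : {additive pathAlg m -> pathAlg m} := pmul << p >> \o pmulr z.
pose h2 : {additive pathAlg m -> pathAlg m} := pmulr z \o pmul << p >>.
rewrite -[LHS]/(g2 y) -[RHS]/(h2 y); apply: malg_span => q _; rewrite /g2 /h2 /= /pmulr.
pose g3 : {additive pathAlg m -> pathAlg m} := pmul << p >> \o pmul << q >>.
pose h3 : {additive pathAlg m -> pathAlg m} := pmul (pmul << p >> << q >>).
rewrite -[LHS]/(g3 z) -[RHS]/(h3 z); apply: malg_span => r _; rewrite /g3 /h3 /=.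
exact: pmulUUU.
Qed.

Lemma pmul_idemU i p : pmul (idem m i) << p >> = if origin p == i then << p >> else 0.
Proof.
have [pi|pi] := eqVneq (origin p) i; last by apply: pmulU0; rewrite eq_sym.
apply: etrans (pmulU_cat (p := vertex_path m i) (esym pi)) _; congr << _ >>; apply: val_inj.
rewrite (gpath_cat_val (p := vertex_path m i) (esym pi)) /= -pi.
by rewrite /origin -surjective_pairing.
Qed.

Lemma pmulU_idem i p : pmul << p >> (idem m i) = if terminus p == i then << p >> else 0.
Proof.
have [pi|pi] := eqVneq (terminus p) i; last exact: pmulU0.
apply: etrans (pmulU_cat (q := vertex_path m i) pi) _; congr << _ >>; apply: val_inj.
by rewrite (gpath_cat_val (q := vertex_path m i) pi) /= cats0 -surjective_pairing.
Qed.

Lemma pmul_idem i : pmul (idem m i) (idem m i) = idem m i.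
Proof. by apply: etrans (pmul_idemU i (vertex_path m i)) _; rewrite eqxx. Qed.

Section Action.
Variables (V : zmodType) (A : pathAlg m -> {additive V -> V}).
Hypothesis AB : forall x y v, A (x - y) v = A x v - A y v.
Hypothesis AM : forall x y v, A (pmul x y) v = A x (A y v).

(** Stated for any action: it serves both [alg_act] on words and left multiplication on the quotient
    ring. *)
Lemma corner_horner_action (e x y : pathAlg m) (f : {poly int}) v :
  A (corner_horner e (pmul x y) f) v = plin (fun l => iter l (fun u => A x (A y u)) (A e v)) f.
Proof.
have Av_additive : zmod_morphism (fun x => A x v) by move=> ? ?; rewrite AB.
pose Av : {additive pathAlg m -> V} := HB.pack (fun x => A x v)
  (GRing.isZmodMorphism.Build _ _ _ Av_additive).
rewrite -[LHS]/(Av _) /corner_horner raddf_sum; apply: eq_bigr => l _.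
rewrite -[X in X *: _]intz scaler_int raddfMz; congr (_ *~ _).
by rewrite /Av /=; elim: (l : nat) => //= n <-; rewrite !AM.
Qed.

End Action.
End PathAlgebraProduct.

Section WordModuleAction.
Variables (I : choiceType) (m : coxeterMatrix I) (k : I).
Implicit Types (i j : I) (p q r : gpath m) (x y : pathAlg m) (w : word I) (z : {malg int[word I]}).
Local Notation act := (word_act m).
Local Notation wmod := {malg int[word I]}.

(** The action of the idempotent at [i]. The end [k] is fixed because the empty word records no
    vertex. *)
Definition word_proj i : wmod -> wmod := lin (fun w => if good m k i w then << w >> else 0).
HB.instance Definition _ i :=
  GRing.isZmodMorphism.Build wmod wmod (word_proj i) (lin_is_additive _).

Lemma path_op_is_additive (V : zmodType) (Y : I -> I -> {additive V -> V}) i s :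
  zmod_morphism (path_op Y i s).
Proof. by elim: s i => //= j s IH i u v; rewrite IH raddfB. Qed.
HB.instance Definition _ V Y i s := GRing.isZmodMorphism.Build V V (path_op Y i s)
  (@path_op_is_additive V Y i s).

Lemma path_op_cat (V : zmodType) (Y : I -> I -> {additive V -> V}) i s t v :
  path_op Y i (s ++ t) v = path_op Y i s (path_op Y (last i s) t v).
Proof. by elim: s i => //= j s IH i; rewrite IH. Qed.

Lemma fits_proj i z : fits m k i (word_proj i z).
Proof.
apply: fits_lin => w _; case: ifP => [|_]; [exact: fitsU|exact: fits0].
Qed.

Lemma word_proj_id i z : fits m k i z -> word_proj i z = z.
Proof. by move=> fz; rewrite -[RHS]malg_lin; apply: eq_lin => w /fz ->. Qed.

Lemma word_proj0 i j z : fits m k i z -> i != j -> word_proj j z = 0.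
Proof.
move=> fz ij; rewrite -[RHS](lin_f0 wmod z); apply: eq_lin => w /fz gi.
by case: ifP => // gj; rewrite (good_inj gi gj) eqxx in ij.
Qed.

(** The projection makes a product of paths that do not compose act as zero. *)
Definition gpath_op p z : wmod := path_op act (origin p) (val p).2 (word_proj (terminus p) z).

Definition alg_act x z : wmod := lin (gpath_op^~ z) x.

Lemma alg_act_is_additive x : zmod_morphism (alg_act x).
Proof.
by move=> u v; rewrite /alg_act -lin_fB; apply: eq_lin => p _; rewrite /gpath_op !raddfB.
Qed.
HB.instance Definition _ x :=
  GRing.isZmodMorphism.Build wmod wmod (alg_act x) (alg_act_is_additive x).

Definition alg_act_at z x := alg_act x z.
Lemma alg_act_at_is_additive z : zmod_morphism (alg_act_at z).
Proof. by move=> x y; rewrite /alg_act_at /alg_act raddfB. Qed.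
HB.instance Definition _ z :=
  GRing.isZmodMorphism.Build (pathAlg m) wmod (alg_act_at z) (alg_act_at_is_additive z).

Lemma alg_actU p z : alg_act << p >> z = gpath_op p z.
Proof. exact: linU. Qed.

Lemma fits_gpath_op p z : fits m k (origin p) (gpath_op p z).
Proof. by apply: fits_path; [exact: valP p|exact: fits_proj]. Qed.

Lemma alg_actUU p q z :
  alg_act (pmul << p >> << q >>) z = alg_act << p >> (alg_act << q >> z).
Proof.
rewrite !alg_actU; have fq := @fits_gpath_op q z.
have [pq|pq] := eqVneq (terminus p) (origin q).
  apply: etrans (congr1 (alg_act_at z) (pmulU_cat pq)) _; apply: etrans (alg_actU _ _) _.
  move: (origin_cat pq) (terminus_cat pq) (gpath_cat_val pq); rewrite {1 2}/gpath_op.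
  move: (gpath_cat p q) => c -> -> -> /=.
  rewrite path_op_cat -[last _ _]/(terminus p) -/(gpath_op q z) pq.
  by rewrite -/(gpath_op q z) (word_proj_id fq).
apply: etrans (congr1 (alg_act_at z) (pmulU0 pq)) _; rewrite raddf0.
by rewrite /gpath_op -/(gpath_op q z) (word_proj0 fq) ?raddf0 // eq_sym.
Qed.

Lemma alg_actM x y z : alg_act (pmul x y) z = alg_act x (alg_act y z).
Proof.
pose g1 : {additive pathAlg m -> wmod} := alg_act_at z \o pmulr y.
pose h1 : {additive pathAlg m -> wmod} := alg_act_at (alg_act y z).
rewrite -[LHS]/(g1 x) -[RHS]/(h1 x); apply: malg_span => p _; rewrite /g1 /h1 /=.
pose g2 : {additive pathAlg m -> wmod} := alg_act_at z \o pmul << p >>.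
pose h2 : {additive pathAlg m -> wmod} := alg_act << p >> \o alg_act_at z.
rewrite /pmulr /alg_act_at -[LHS]/(g2 y) -[RHS]/(h2 y).
by apply: malg_span => q _; apply: alg_actUU.
Qed.

Lemma alg_act_idem i z : alg_act (idem m i) z = word_proj i z.
Proof. by rewrite alg_actU. Qed.

(** The word module thus becomes a module over the quotient ring; the generators act as zero by
    [word_act_relation]. *)
Lemma alg_act_ideal x z : in_cox_ideal x -> alg_act x z = 0.
Proof.
move=> xI; elim: xI z => {x} [n i j e e' mij||x y _ IHx _ IHy|a x _ IH|a x _ IH] z.
- rewrite /cox_relator (@corner_horner_action I m _ alg_act); last 2 first.
  + by move=> x y v; apply: (raddfB (alg_act_at v)).
  + exact: alg_actM.
  apply: etrans (congr1 (fun t => plin (fun l => iter l _ t) _) (alg_act_idem i z)) _.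
  rewrite -[RHS](word_act_relation mij e (@fits_proj i z)).
  apply: eq_plin => l _; elim: l => //= l ->.
  have fr : fits m k i (iter l (edge_loop act i j) (word_proj i z)).
    elim: l => [|l IH]; first exact: fits_proj.
    by apply: fits_word_act => //; apply: fits_word_act.
  rewrite /edge_elt !alg_actU /gpath_op /edge_loop /= /terminus /origin /=.
  by rewrite (word_proj_id fr) word_proj_id //; apply: fits_word_act.
- exact: (raddf0 (alg_act_at z)).
- apply: etrans (raddfB (alg_act_at z) x y) _.
  by rewrite /= /alg_act_at IHx IHy subrr.
- by rewrite alg_actM IH raddf0.
- by rewrite alg_actM IH.
Qed.

End WordModuleAction.

(** * Comparison with the quotient ring *)

Section CoxRingModule.
Variables (I : choiceType) (m : coxeterMatrix I).
Implicit Types (i j k : I) (x y : pathAlg m) (u v : coxRing m).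

Lemma toCoxK u : toCox (repr u) = u.
Proof. exact: reprK. Qed.

Lemma toCox_is_additive : zmod_morphism (@toCox I m).
Proof. by move=> x y; rewrite /toCox raddfB. Qed.
HB.instance Definition _ :=
  GRing.isZmodMorphism.Build (pathAlg m) (coxRing m) (@toCox I m) toCox_is_additive.

Definition lmul x v := cmul (toCox x) v.

Lemma lmul_toCox x y : lmul x (toCox y) = toCox (pmul x y).
Proof. exact: cmul_toCox. Qed.

Lemma lmul_is_additive x : zmod_morphism (lmul x).
Proof.
move=> u v; rewrite -[u]toCoxK -[v]toCoxK -toCox_is_additive !lmul_toCox.
by rewrite pmulBr toCox_is_additive.
Qed.
HB.instance Definition _ x :=
  GRing.isZmodMorphism.Build (coxRing m) (coxRing m) (lmul x) (lmul_is_additive x).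

Lemma lmulBl x y v : lmul (x - y) v = lmul x v - lmul y v.
Proof. by rewrite -[v]toCoxK !lmul_toCox pmulBl toCox_is_additive. Qed.

Lemma lmulM x y v : lmul (pmul x y) v = lmul x (lmul y v).
Proof. by rewrite -[v]toCoxK !lmul_toCox pmulA. Qed.

Lemma lmul0l v : lmul 0 v = 0.
Proof. by rewrite -[X in lmul X v](subrr 0) lmulBl subrr. Qed.

(** Made total by the value [0] off the edges, so as to give a family of the form [Y]. *)
Definition edge_gen i j : pathAlg m :=
  if pselect (edge m i j) is left e then edge_elt e else 0.

Lemma edge_genE i j (e : edge m i j) : edge_gen i j = edge_elt e.
Proof. by rewrite /edge_gen; case: pselect => // e'; rewrite (bool_irrelevance e e'). Qed.

Definition edge_mul i j : coxRing m -> coxRing m := lmul (edge_gen i j).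
HB.instance Definition _ i j := GRing.Additive.on (edge_mul i j).

Definition lcorner i v := lmul (idem m i) v = v.

Lemma lcorner_edge_mul i j v : edge m i j -> lcorner j v -> lcorner i (edge_mul i j v).
Proof.
move=> e _; rewrite /lcorner /edge_mul -lmulM (edge_genE e); congr (lmul _ _).
by apply: etrans (pmul_idemU i (edge_path e)) _; rewrite eqxx.
Qed.

Lemma edge_mul_relation i j n v : m i j = Some n -> edge m i j -> lcorner i v ->
  plin (fun r => iter r (edge_loop edge_mul i j) v) (cox_poly n) = 0.
Proof.
move=> mij e vi; have e' : edge m j i by rewrite edge_sym.
have A u : edge_mul i j (edge_mul j i u) = lmul (edge_elt e) (lmul (edge_elt e') u).
  by rewrite /edge_mul (edge_genE e) (edge_genE e').
apply: etrans _ (etrans (esym (corner_horner_action lmulBl lmulM (idem m i)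
  (edge_elt e) (edge_elt e') (cox_poly n) v)) _).
  apply: eq_plin => l _; elim: l => [|l IH] /=; first exact: esym vi.
  apply: etrans (congr1 (edge_loop edge_mul i j) IH) _.
  by move: (iter _ _ _) => t; apply: A.
rewrite -/(cox_relator n e e') /lmul -[RHS](lmul0l v) /lmul; congr cmul.
by apply/toCox_eq; rewrite subr0; apply: cox_ideal_gen.
Qed.

Lemma toCox_path i s (ps : path (edge m) i s) :
  path_op edge_mul i s (toCox (idem m (last i s))) =
  toCox << GPath (gpath_val := (i, s)) ps : gpath m >>.
Proof.
elim: s i ps => [|j s IH] i ps /=.
  by congr (toCox << _ >>); apply: val_inj.
have /andP[e pjs] := ps; rewrite (IH j pjs) /edge_mul lmul_toCox (edge_genE e).
pose q : gpath m := GPath (gpath_val := (j, s)) pjs.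
have eq : terminus (edge_path e) = origin q by [].
apply: (congr1 (@toCox I m)); apply: etrans (pmulU_cat eq) _; congr << _ >>.
by apply: val_inj; rewrite (gpath_cat_val eq).
Qed.

End CoxRingModule.

Section WordCoordinates.
Variables (I : choiceType) (m : coxeterMatrix I).
Variables (V : zmodType) (Y : I -> I -> {additive V -> V}) (S : I -> V -> Prop).
Hypothesis SY : forall i j v, edge m i j -> S j v -> S i (Y i j v).
Hypothesis S_rel : forall i j n v, m i j = Some n -> edge m i j -> S i v ->
  plin (fun r => iter r (edge_loop Y i j) v) (cox_poly n) = 0.

Lemma star_gpath_op k (p : gpath m) v : S k v ->
  star Y (gpath_op k p << [::] >>) v =
  if terminus p == k then path_op Y (origin p) (val p).2 v else 0.
Proof.
move=> Sv; rewrite /gpath_op /word_proj linU /=.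
case: eqP => [pk|_]; last by rewrite raddf0; exact: (raddf0 (star_at Y v)).
by apply: (star_path SY S_rel); [exact: (valP p)|rewrite -/(terminus p) pk].
Qed.

End WordCoordinates.

(** * Faithfulness of the word coordinates *)

Section Faithful.
Variables (I : choiceType) (m : coxeterMatrix I).
Implicit Types (i j k : I) (x y : pathAlg m) (z : {malg int[word I]}).

(** [alg_act k x << [::] >>] gives the word coordinates of [x]. Evaluating them in the quotient ring
    recovers the class of [x] cut at [k], so no information is lost there. *)
Lemma star_alg_act k x : star (@edge_mul I m) (alg_act k x << [::] >>) (toCox (idem m k)) =
  toCox (pmul x (idem m k)).
Proof.
pose g : {additive pathAlg m -> coxRing m} :=
  star_at (@edge_mul I m) (toCox (idem m k)) \o alg_act_at k << [::] >>.
pose h : {additive pathAlg m -> coxRing m} := @toCox I m \o pmulr (idem m k).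
rewrite -[LHS]/(g x) -[RHS]/(h x); apply: malg_span => p _; rewrite /g /h /=.
rewrite /star_at /alg_act_at alg_actU.
rewrite (star_gpath_op (@lcorner_edge_mul I m) (@edge_mul_relation I m)); last first.
  by rewrite /lcorner lmul_toCox pmul_idem.
apply: etrans (congr1 (@toCox I m) (esym (pmulU_idem k p))).
case: eqP => [<-|_]; last by rewrite raddf0.
apply: etrans (toCox_path (valP p)) _.
by congr (toCox << _ >>); apply: val_inj; exact/esym/surjective_pairing.
Qed.

(** For [z] the coordinates of a second factor, this turns the product of the path algebra into
    [star]. *)
Lemma star_alg_act_word j k x z : fits m k j z ->
  star (word_act m) (alg_act j x << [::] >>) z = alg_act k x z.
Proof.
move=> fz.
pose g : {additive pathAlg m -> {malg int[word I]}} :=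
  star_at (word_act m) z \o alg_act_at j << [::] >>.
pose h : {additive pathAlg m -> {malg int[word I]}} := alg_act_at k z.
rewrite -[LHS]/(g x) -[RHS]/(h x); apply: malg_span => p _; rewrite /g /h /=.
rewrite /star_at /alg_act_at !alg_actU.
rewrite (star_gpath_op (S := fits m k) (@fits_word_act I m k) (@word_act_relation I m k)) //.
rewrite /gpath_op; case: eqVneq => [->|pj]; first by rewrite (word_proj_id fz).
by rewrite (word_proj0 fz) ?raddf0 // eq_sym.
Qed.

Lemma fits_alg_act_corner i j x z : fits m j i (alg_act j (pmul (idem m i) x) z).
Proof. by rewrite alg_actM alg_act_idem; apply: fits_proj. Qed.

End Faithful.

(** * Corners of the quotient ring *)

Lemma in_corner_toCox (I : choiceType) (m : coxeterMatrix I) i j (x : coxRing m) :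
  in_corner i j x -> exists y, [/\ x = toCox y, y = pmul (idem m i) y & y = pmul y (idem m j)].
Proof.
case=> r ->; exists (pmul (pmul (idem m i) (repr r)) (idem m j)).
split; first by rewrite -{1}[r]toCoxK !cmul_toCox.
  by rewrite !pmulA pmul_idem.
by rewrite -[RHS]pmulA pmul_idem.
Qed.

Lemma alg_act_eq0 (I : choiceType) (m : coxeterMatrix I) k (y : pathAlg m) :
  y = pmul y (idem m k) -> alg_act k y << [::] >> = 0 -> toCox y = 0.
Proof.
move=> yE y0; rewrite yE -star_alg_act y0.
exact: (raddf0 (star_at (@edge_mul I m) _)).
Qed.

Theorem corollary8p3 (I : choiceType) (WS : coxeterSystem I) (i j k : I)
    (x1 x2 : coxRing WS) :
  in_corner i j x1 -> in_corner j k x2 -> cmul x1 x2 = 0 ->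
  x1 = 0 \/ x2 = 0.
Proof.
move=> /in_corner_toCox[y1 [-> iy1 y1j]] /in_corner_toCox[y2 [-> jy2 y2k]].
rewrite cmul_toCox => y12; pose X1 := alg_act j y1 << [::] >>.
pose X2 := alg_act k y2 << [::] >>.
have fX1 : fits WS j i X1 by rewrite /X1 iy1; apply: fits_alg_act_corner.
have fX2 : fits WS k j X2 by rewrite /X2 jy2; apply: fits_alg_act_corner.
(* The product of the representatives lies in the ideal, which acts as zero on words. *)
have X12 : star (word_act WS) X1 X2 = 0.
  rewrite /X1 (star_alg_act_word _ fX2) -alg_actM; apply: alg_act_ideal.
  by rewrite -[pmul _ _]subr0; apply/toCox_eq; rewrite y12 raddf0.
have [X10|X10] := eqVneq X1 0; first by left; apply: alg_act_eq0 y1j X10.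
have [p _ pmax] := max_msupp size X10.
have [||X20] := star_eq0 (N := (size p).+1) fX1 fX2 _ X12.
- by move=> q /pmax; rewrite ltnS.
- by move/eqP: X10.
by right; apply: alg_act_eq0 y2k X20.
Qed.
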